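(* Let $m\ge 1$ and $n\ge 2$ be integers. The equivalence group of the general linear homogeneous system $$\mathbf{y}^{(n)} + B_n^1\,\mathbf{y}^{(n-1)} + \dots + B_n^k\,\mathbf{y}^{(n-k)} + \dots + B_n^n\,\mathbf{y} = 0,\qquad \mathbf{y}=\mathbf{y}(x)\in\mathbb{K}^m,$$ with arbitrary $m\times m$ matrix coefficient functions $B_n^k = (B^k_{ij}(x))$, consists of the invertible point transformations of the form $$x = f(z),\qquad \mathbf{y} = T\,\mathbf{w}.$$ For the normal form of this system, in which the coefficient $B_n^1$ of the term of order $n-1$ has vanished, these transformations reduce to those of the form $$x = f(z),\qquad \mathbf{y} = f'(z)^{(n-1)/2}\, C\,\mathbf{w}.$$ Here $T=(T_{ij}(z))$ is an $m\times m$ matrix, $f$ and the entries $T_{ij}$ of $T$ are smooth functions of $z$, and $C=(C_{ij})$ is a constant $m\times m$ matrix with entries in $\mathbb{K}$.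
   Context: The base field $\mathbb{K}$ is a field of characteristic zero. The new independent variable is $z$ and the new dependent variable is $\mathbf{w}=\mathbf{w}(z)\in\mathbb{K}^m$. A point transformation is a change of variables $x=f(z,\mathbf{w})$, $\mathbf{y}=T(z,\mathbf{w})$, with $f$ scalar-valued and $T$ vector-valued, both smooth. The equivalence group of a family of equations (here: all linear homogeneous systems of order $n$ of the displayed form with arbitrary coefficients; respectively, all such systems with $B_n^1=0$) is the group of invertible point transformations leaving the family invariant, i.e. mapping each equation of the family to an equation of the same family (possibly with different coefficients), where the transformed system is normalized to have leading coefficient the identity matrix. Invertibility of the transformations is part of the statement (so $f'\neq 0$, and $T$, respectively $C$, is invertible).
   Formalization: K is a normed field where zero derivative on a ball forces a constant (e.g. R, C), as the claim fails over Q; transformations live on products of open connected sets; f'^((n-1)/2) means a smooth g with g^2 = c f'^(n-1), c a nonzero constant, since the power may be undefined (f'<0, n even). *)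

(* Defs.v *)
From HB Require Import structures.
From mathcomp Require Import all_boot all_order all_algebra.
From mathcomp Require Import all_classical all_reals.
From mathcomp Require Import topology normedtype landau derive realfun.
From mathcomp Require Import complex lra.

Set Implicit Arguments.
Unset Strict Implicit.
Unset Printing Implicit Defensive.

Import Order.TTheory GRing.Theory Num.Theory.
Import numFieldNormedType.Exports.

Local Open Scope classical_set_scope.
Local Open Scope ring_scope.

(* A differential calculus needs a base field whose functions with zero
   derivative on a ball are constant.  In a general numFieldType this is an extra
   property (it fails over rat); below it is proved for every realType R, and
   for its complex field R[i], where smooth means holomorphic. *)
Definition constants_of_derivation (K : numFieldType) : Prop :=
  forall (a r : K) (g : K -> K),
    (forall t, ball a r t -> is_derive t 1 g 0) ->
    forall t, ball a r t -> g t = g a.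

Lemma constants_of_derivation_real (R : realType) : constants_of_derivation R.
Proof.
move=> a r g g0 t art.
have main (x y : R) : x <= y -> ball a r x -> ball a r y -> g x = g y.
  move=> xy bx byy.
  have bs s : s \in `[x, y]%R -> ball a r s.
    rewrite in_itv /= => /andP[xs sy]; move: bx byy.
    rewrite -!ball_normE /ball_ /= !ltr_distlC => /andP[ax xa] /andP[ay ya].
    by rewrite (lt_le_trans ax xs) (le_lt_trans sy ya).
  have [||c _] := @MVT_segment R g (fun=> 0) x y xy.
  - by move=> s /subset_itv_oo_cc /bs /g0.
  - apply: continuous_in_subspaceT => s /set_mem /= /bs /g0 gs.
    exact/differentiable_continuous/derivable1_diffP.
  by rewrite mul0r => /eqP; rewrite subr_eq0 => /eqP ->.
have baa : ball a r a.
  apply: ballxx; move: art; rewrite -ball_normE /ball_ /=.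
  exact: le_lt_trans.
by case: (leP a t) => [/main->//|/ltW /main->].
Qed.

Lemma near_derive0 (K : numFieldType) (g : K -> K) (t : K) :
  is_derive t 1 g 0 ->
  forall e : K, 0 < e -> \forall h \near 0, `|g (t + h) - g t| <= e * `|h|.
Proof.
move=> [dg g0] e e0; have := derivable_nbhs dg.
rewrite g0 => /eqaddoP /(_ e e0); apply: filterS => h.
by rewrite /= ?fctE /= scaler0 addr0 [h%:A]mulr1 (addrC t).
Qed.

Lemma constants_of_derivation_complex (R : realType) :
  constants_of_derivation R[i].
Proof.
move=> a r g g0 t art.
pose gam (s : R) : R[i] := a + s%:C%C * (t - a).
have balla (s : R) : 0 <= s <= 1 -> ball a r (gam s).
  move=> /andP[s0 s1]; move: art; rewrite -!ball_normE /ball_ /gam /=.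
  rewrite opprD addrA subrr sub0r normrN normrM distrC => /(le_lt_trans _); apply.
  rewrite ler_piMl // normc_def /= expr0n /= addr0 sqrtr_sqr lecR.
  by rewrite ger0_norm.
have norm_real (x : R) : `|x%:C%C| = `|x|%:C%C :> R[i].
  by rewrite normc_def /= expr0n /= addr0 sqrtr_sqr.
have lin (L : R[i] -> R) : (forall x y : R[i], L (x - y) = L x - L y) ->
    (forall x, `|L x|%:C%C <= `|x|) -> L (g t) = L (g a).
  move=> LB Lle; pose h s := L (g (gam s)).
  have h0 (s : R) : 0 <= s <= 1 -> is_derive s (1 : R) h 0.
    move=> /balla /g0 gs.
    suff H : (fun k : R => k^-1 *: ((h \o shift s) (k *: (1 : R)) - h s)) @ 0^'
        --> (0 : R).
      by apply: DeriveDef; [exact: (cvgP _ H) | exact: cvg_lim H].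
    apply/cvgrPdist_le => e e0.
    pose N := complex.Re (`|t - a| : R[i]) + 1.
    have tN : `|t - a| = (N - 1)%:C%C :> R[i].
      rewrite /N addrK. rewrite RRe_real //; exact: normr_real.
    have N1 : 0 <= N - 1 by rewrite -lecR -tN normr_ge0.
    have N0 : 0 < N by lra.
    have eN0 : (0 : R[i]) < (e / N)%:C%C by rewrite ltcR divr_gt0.
    have /nbhs_ballP[d /= d0 dP] := near_derive0 gs eN0.
    have dR : d = (complex.Re d)%:C%C by rewrite RRe_real // gtr0_real.
    have dr0 : 0 < complex.Re d by rewrite -ltcR -dR.
    have dN0 : 0 < complex.Re d / N by rewrite divr_gt0.
    near=> k.
    have k0 : k != 0 by near: k; exact: nbhs_dnbhs_neq.
    have kd : `|k| < complex.Re d / N.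
      by near: k; apply: dnbhs0_lt.
    have nk : `|k%:C%C * (t - a)| = (`|k| * (N - 1))%:C%C :> R[i].
      by rewrite normrM norm_real tN -rmorphM.
    have kNd : `|k| * (N - 1) < complex.Re d.
      rewrite (@le_lt_trans _ _ (`|k| * N)) //.
        by rewrite ler_wpM2l // gerBl.
      by rewrite -ltr_pdivlMr.
    have := dP (k%:C%C * (t - a)).
    rewrite -ball_normE /ball_ /= sub0r normrN nk dR ltcR => /(_ kNd) gk.
    rewrite sub0r normrN normrZ normfV ler_pdivrMl ?normr_gt0 //.
    rewrite /h /= -LB -lecR (le_trans (Lle _)) //.
    have -> : gam (k *: (1 : R) + s) = gam s + k%:C%C * (t - a).
      by rewrite /gam [k *: _]mulr1 rmorphD /= mulrDl [X in a + X]addrC addrA.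
    apply: le_trans gk _; rewrite -rmorphM lecR /=.
    rewrite mulrCA ler_wpM2l // mulrAC ler_pdivrMr // ler_wpM2l //; lra.
  have [| | |c _] := @MVT_segment R h (fun=> 0) 0 1; first exact: ler01.
  - by move=> s; rewrite in_itv /= => /andP[s0 s1]; apply: h0; rewrite !ltW.
  - apply: continuous_in_subspaceT => s /set_mem /=; rewrite in_itv /= => /h0 hs.
    exact/differentiable_continuous/derivable1_diffP.
  rewrite mul0r => /eqP; rewrite subr_eq0 /h /gam => /eqP.
  by rewrite mul1r mul0r addr0 addrC subrK.
apply/eqP; rewrite eq_complex; apply/andP; split; apply/eqP.
- by apply: lin => [x y|x]; [rewrite raddfB|exact: normc_ge_Re].
- apply: lin => [x y|x]; first by rewrite raddfB.
  rewrite normc_def lecR -sqrtr_sqr ler_wsqrtr // lerDr.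
  exact: sqr_ge0.
Unshelve. all: by end_near. Qed.

Section Smooth.
Variables (K : numFieldType) (E F : normedModType K).

Fixpoint smooth_order (k : nat) (U : set E) (g : E -> F) : Prop :=
  if k is k'.+1 then
    (forall p, U p -> differentiable g p) /\
    (forall v, smooth_order k' U ('D_v g))
  else forall p, U p -> {for p, continuous g}.

Definition smooth (U : set E) (g : E -> F) : Prop :=
  forall k, smooth_order k U g.

Definition domain (U : set E) : Prop := [/\ open U, connected U & U !=set0].

End Smooth.

Section LinearSystems.
Variables (K : numFieldType) (m n : nat).

(* [B k] is the coefficient of the derivative of order [n - k], for
   [1 <= k <= n]; the values of [B] at other indices are irrelevant. *)
Definition coefficients : Type := nat -> K -> 'M[K]_m.

Definition general_family (J : set K) (B : coefficients) : Prop :=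
  forall k, (1 <= k <= n)%N -> smooth J (B k).

Definition normal_family (J : set K) (B : coefficients) : Prop :=
  general_family J B /\ (forall x, J x -> B 1%N x = 0).

(* The equation at the point [x] for the jet whose derivative of order [j] is
   [u j]. *)
Definition jet_equation (B : coefficients) (x : K) (u : nat -> 'cV[K]_m) :
    Prop :=
  u n + \sum_(1 <= k < n.+1) B k x *m u (n - k)%N = 0.

(* The derivatives of y with respect to x along the curve z |-> (X z, Y z),
   computed with d/dx = (1 / X') d/dz. *)
Definition dx (X : K -> K) (j : nat) (Y : K -> 'cV[K]_m) : K -> 'cV[K]_m :=
  iter j (fun V z => (derive1 X z)^-1 *: derive1 V z) Y.

Definition point_transformation : Type :=
  K * 'cV[K]_m -> K * 'cV[K]_m.

Definition invertible_on (U : set (K * 'cV[K]_m)) (phi : point_transformation) :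
    Prop :=
  [/\ smooth U phi, open (phi @` U) &
   exists2 psi : point_transformation,
     smooth (phi @` U) psi & forall p, U p -> psi (phi p) = p].

(* [(x, y) = phi (z, w)] turns the system with coefficients [B] into the one
   with coefficients [C]: after substitution the two systems impose the same
   condition on the jet of [w] at every point where x can be used as the
   independent variable along the graph of [w].  A system of the form
   [jet_equation] has leading coefficient 1, so no multiplier appears. *)
Definition transforms (D : set K) (W : set 'cV[K]_m)
    (phi : point_transformation) (B C : coefficients) : Prop :=
  forall (O : set K) (w : K -> 'cV[K]_m),
    open O -> O `<=` D -> smooth O w -> (forall z, O z -> W (w z)) ->
    let X := fun z => (phi (z, w z)).1 in
    let Y := fun z => (phi (z, w z)).2 in
    (forall z, O z -> derive1 X z != 0) ->
    forall z, O z ->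
      jet_equation B (X z) (fun j => dx X j Y z) <->
      jet_equation C z (fun j => derive1n j w z).

Definition equivalence_transformation
    (family : set K -> coefficients -> Prop)
    (D : set K) (W : set 'cV[K]_m) (phi : point_transformation) : Prop :=
  invertible_on (D `*` W) phi /\
  forall B, family (fst @` (phi @` (D `*` W))) B ->
    exists2 C, family D C & transforms D W phi B C.

End LinearSystems.

(* [g] is the power [h ^ (k / 2)], as a smooth function determined up to a
   nonzero constant factor.  The constant [c] is needed when [h] has no square
   root in [K]: over the reals, it allows |h| ^ (k / 2) when [h < 0]. *)
Definition half_power (K : numFieldType) (D : set K) (h : K -> K) (k : nat)
    (g : K -> K) : Prop :=
  smooth D g /\
  exists2 c : K, c != 0 & forall z, D z -> g z ^+ 2 = c * h z ^+ k.

(* Main.v *)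
From HB Require Import structures.
Require Import Defs.
From mathcomp Require Import all_boot all_order all_algebra.
From mathcomp Require Import all_classical all_reals.
From mathcomp Require Import topology normedtype landau derive.
From mathcomp Require Import perm zify ring.

Set Implicit Arguments.
Unset Strict Implicit.
Unset Printing Implicit Defensive.

Import Order.TTheory GRing.Theory Num.Theory.
Import numFieldNormedType.Exports.

Local Open Scope classical_set_scope.
Local Open Scope ring_scope.

(** Everything happens on jets: at a point [(z0, w0)] any jet of [w] is realized
    by a polynomial curve, so the equivalence of two equations is a statement
    about finitely many derivatives at one point.  Write [x = f(z, w)] and
    [y = t(z, w)] for the given transformation.

    Why [f] does not depend on [w].  Compare [y^(n) = 0] with [y^(n) + y = 0].
    For given lower derivatives of [w], the two transformed equations prescribe
    derivatives of order [n] differing by a vector [d] affine in [w'], while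
    the derivatives of order [n] of [y] differ by [t].  The top derivative
    enters through the differential of the transformation alone
    ([dxs_sub_top]), which gives [shift_identity]:
    [t * X' ^ (n + 1) = (t_w d) X' - (f_w d) Y'] with [X' = f_z + f_w w'] and
    [Y' = t_z + t_w w'].  The right-hand side has degree at most two in [w'];
    the left-hand side has degree [n + 1 > 2] if [f_w] and [t] do not vanish.
    Hence [f_w = 0] where [t] is nonzero ([fx_vertical_derive0]), and everywhere
    because [t] vanishes on no open set ([fx_vertical]).

    Why [t] is linear in [w].  For [y^(n) = 0] add to a solution two
    perturbations in the direction [v], one through [w'] and one through the
    derivative of order [n - 1].  The transformed equation is linear, so all four
    combinations are solutions, and the second difference of [y] along them has
    derivative of order [n] zero; that derivative is a nonzero multiple of the
    second derivative of [t] along [v] ([lead_second_difference],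
    [ty_second_derive0]).  So [t] is locally, then globally affine in [w].  At
    zero velocity [shift_identity] now reads [t * f' ^ n = t_w d] with [d]
    linear in [w], which excludes a constant term ([ty_linear]).

    Conversely, [y = T w] is differentiated explicitly ([dx_linear]); its leading
    coefficient is invertible, so the substituted system can be normalized
    ([transforms_transformed]).

    In the normal form the only further condition is the vanishing of the
    coefficient of order [n - 1], which is the equation
    [2 f' T' = (n - 1) f'' T] ([expansion_subdiag_eq0]).  It forces the product of
    any two entries of [T] to be a constant times [f' ^ (n - 1)]
    ([ode_product_const]); a nonzero entry is therefore a half power of [f'], and
    the other entries are constant multiples of it ([ode_half_power]). *)

(** * Smooth functions *)
Section SmoothCalculus.
Variable K : numFieldType.
Implicit Types E F G : normedModType K.

(** The difference of the two functions vanishes near [p], hence has differential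
    zero there. *)
Lemma near_eq_differentiable E F (f g : E -> F) p :
  (\near p, f p = g p) -> differentiable f p -> differentiable g p.
Proof.
move=> fg df; have dh : differentiable (g - f) p.
  have h0 : \forall x \near p, (g - f) x = 0.
    by apply: filterS fg => x; rewrite !fctE => ->; rewrite subrr.
  have gfp : (g - f) p = 0 by exact: nbhs_singleton h0.
  have exp : (g - f) \o shift p = cst ((g - f) p) + (0 : E -> F) +o_ 0 id.
    apply/eqaddoP => e e0; rewrite gfp.
    have : \forall x \near 0, (g - f) (x + p) = 0.
      rewrite (near_shift p); near=> x.
      by rewrite /= sub0r addrNK; near: x.
    apply: filterS => x hx.
    rewrite [X in `|X|](_ : _ = (g - f) (x + p)); last first.
      by rewrite !fctE /= addr0 subr0.
    rewrite hx normr0.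
    by rewrite mulr_ge0 // ltW.
  have c0 : continuous (\0 : {linear E -> F}) by exact: cst_continuous.
  by apply/diff_locallyP; rewrite (@diff_unique K _ _ _ (\0 : {linear E -> F}) _ c0 exp).
have -> : g = f + (g - f) by rewrite addrC subrK.
exact: differentiableD.
Unshelve. all: by end_near. Qed.

Lemma smooth_order_ext E F (U : set E) (f g : E -> F) k :
  open U -> (forall p, U p -> f p = g p) ->
  smooth_order k U f -> smooth_order k U g.
Proof.
move=> oU; have nfg (f1 g1 : E -> F) p : (forall p, U p -> f1 p = g1 p) -> U p ->
    \forall q \near p, f1 q = g1 q.
  by move=> fg Up; apply: filterS (open_nbhs_nbhs (conj oU Up)).
elim: k f g => [|k IH] f g fg /=.
  move=> cf p Up; have cfp := cf p Up; rewrite /prop_for /continuous_at -(fg _ Up).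
  apply: cvg_trans cfp; apply: near_eq_cvg.
  exact: nfg.
move=> [df sf]; split=> [p Up|v].
  by apply: near_eq_differentiable (df _ Up); exact: nfg.
by apply: IH (sf v) => p Up; apply: near_eq_derive; exact: nfg.
Qed.

Lemma smooth_orderW E F (U : set E) (f : E -> F) k :
  smooth_order k.+1 U f -> smooth_order k U f.
Proof.
elim: k f => [|k IH] f [df sf] /=.
  by move=> p Up; exact/differentiable_continuous/df.
by split=> // v; exact: IH.
Qed.

Lemma smooth_ext E F (U : set E) (f g : E -> F) :
  open U -> (forall p, U p -> f p = g p) -> smooth U f -> smooth U g.
Proof. by move=> oU fg sf k; exact: smooth_order_ext (sf k). Qed.

Lemma smooth_subset E F (U V : set E) (f : E -> F) :
  V `<=` U -> smooth U f -> smooth V f.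
Proof.
move=> VU sf k; move: {sf}(sf k); elim: k f => [|k IH] f /=.
  by move=> cf p /VU; exact: cf.
by move=> [df sf]; split=> [p /VU /df //|v]; exact: IH.
Qed.

Lemma smooth_differentiable E F (U : set E) (f : E -> F) p :
  smooth U f -> U p -> differentiable f p.
Proof. by move=> /(_ 1%N)[df _] /df. Qed.

Lemma smooth_continuous E F (U : set E) (f : E -> F) p :
  smooth U f -> U p -> {for p, continuous f}.
Proof. by move=> /(_ 0%N); exact. Qed.

Lemma smooth_derive E F (U : set E) (f : E -> F) v :
  smooth U f -> smooth U ('D_v f).
Proof. by move=> sf k; have [_] := sf k.+1; exact. Qed.

Lemma smooth_order_cst E F (U : set E) (c : F) k : smooth_order k U (cst c).
Proof.
elim: k c => [|k IH] c /=; first by move=> p _; exact: cst_continuous.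
split=> [p _|v]; first exact: differentiable_cst.
have -> : 'D_v (cst c) = cst (0 : F) :> (E -> F).
  by apply/funext => x; rewrite derive_cst.
exact: IH.
Qed.

Lemma smooth_cst E F (U : set E) (c : F) : smooth U (cst c).
Proof. by move=> k; exact: smooth_order_cst. Qed.

Lemma smooth_linear_comp E F G (U : set E) (L : {linear F -> G}) (f : E -> F) :
  open U -> continuous L -> smooth U f -> smooth U (L \o f).
Proof.
move=> oU cL sf k; move: {sf}(sf k); elim: k f => [|k IH] f /=.
  by move=> cf p Up; apply: continuous_comp; [exact: cf|exact: cL].
move=> [df sf]; split=> [p Up|v].
  by apply: differentiable_comp; [exact: df|exact: linear_differentiable].
apply: (smooth_order_ext oU _ (IH _ (sf v))) => p Up /=.
have dp := df _ Up.
have dL : differentiable L (f p) by exact: linear_differentiable.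
rewrite (deriveE _ dp) (deriveE _ (differentiable_comp dp dL)).
by rewrite (diff_comp dp dL) (diff_lin _ cL).
Qed.

Lemma smooth_orderD E F (U : set E) (f g : E -> F) k :
  open U -> smooth_order k U f -> smooth_order k U g ->
  smooth_order k U (f \+ g).
Proof.
move=> oU; elim: k f g => [|k IH] f g /=.
  by move=> cf cg p Up; apply: continuousD; [exact: cf|exact: cg].
move=> [df sf] [dg sg]; split=> [p Up|v].
  by apply: differentiableD; [exact: df|exact: dg].
apply: (smooth_order_ext oU _ (IH _ _ (sf v) (sg v))) => p Up /=.
by rewrite -deriveD //; apply: diff_derivable; [exact: df|exact: dg].
Qed.

Lemma smoothD E F (U : set E) (f g : E -> F) :
  open U -> smooth U f -> smooth U g -> smooth U (f \+ g).
Proof. by move=> oU sf sg k; exact: smooth_orderD. Qed.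

Lemma smooth_order_sum E F (U : set E) I (r : seq I) (f : I -> E -> F) k :
  open U -> (forall i, smooth_order k U (f i)) ->
  smooth_order k U (fun p => \sum_(i <- r) f i p).
Proof.
move=> oU sf; elim: r => [|i r IH].
  apply: (smooth_order_ext oU _ (@smooth_order_cst E F U 0 k)) => p _ /=.
  by rewrite big_nil.
apply: (smooth_order_ext oU _ (smooth_orderD oU (sf i) IH)) => p _ /=.
by rewrite big_cons.
Qed.

Lemma smooth_sum E F (U : set E) I (r : seq I) (f : I -> E -> F) :
  open U -> (forall i, smooth U (f i)) ->
  smooth U (fun p => \sum_(i <- r) f i p).
Proof. by move=> oU sf k; apply: smooth_order_sum => // i; exact: sf. Qed.

Lemma smooth_orderM E (U : set E) (f g : E -> K) k :
  open U -> smooth_order k U f -> smooth_order k U g ->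
  smooth_order k U (f \* g).
Proof.
move=> oU; elim: k f g => [|k IH] f g sf sg.
  by move=> p Up; apply: continuousM; [exact: sf|exact: sg].
have sf' := smooth_orderW sf; have sg' := smooth_orderW sg.
move: sf sg => [df sf] [dg sg]; split=> [p Up|v].
  by apply: differentiableM; [exact: df|exact: dg].
apply: (smooth_order_ext oU _
  (smooth_orderD oU (IH _ _ sf' (sg v)) (IH _ _ sg' (sf v)))) => p Up.
rewrite [RHS]deriveM //; apply: diff_derivable; [exact: df|exact: dg].
Qed.

Lemma smoothM E (U : set E) (f g : E -> K) :
  open U -> smooth U f -> smooth U g -> smooth U (f \* g).
Proof. by move=> oU sf sg k; exact: smooth_orderM. Qed.

Lemma smoothZ E (U : set E) (c : K) (f : E -> K) :
  open U -> smooth U f -> smooth U (fun p => c * f p).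
Proof.
by move=> oU; apply: smoothM => //; exact: smooth_cst.
Qed.

Lemma smoothB E (U : set E) (f g : E -> K) :
  open U -> smooth U f -> smooth U g -> smooth U (f \- g).
Proof.
move=> oU sf sg; apply: (smooth_ext oU _ (smoothD oU sf (smoothZ (-1) oU sg))).
by move=> p _ /=; rewrite mulN1r.
Qed.

Lemma smoothX E (U : set E) (f : E -> K) j :
  open U -> smooth U f -> smooth U (fun p => f p ^+ j).
Proof.
move=> oU sf; elim: j => [|j IH].
  by apply: (smooth_ext oU _ (smooth_cst U (1 : K))) => p _; rewrite expr0.
by apply: (smooth_ext oU _ (smoothM oU sf IH)) => p _; rewrite exprS.
Qed.

Lemma smooth_prod E (U : set E) I (r : seq I) (f : I -> E -> K) :
  open U -> (forall i, smooth U (f i)) ->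
  smooth U (fun p => \prod_(i <- r) f i p).
Proof.
move=> oU sf; elim: r => [|i r IH].
  by apply: (smooth_ext oU _ (smooth_cst U (1 : K))) => p _; rewrite big_nil.
by apply: (smooth_ext oU _ (smoothM oU (sf i) IH)) => p _; rewrite big_cons.
Qed.

Lemma smoothV E (U : set E) (f : E -> K) :
  open U -> (forall p, U p -> f p != 0) -> smooth U f ->
  smooth U (fun p => (f p)^-1).
Proof.
move=> oU f0 sf; elim=> [|k IH].
  by move=> p Up; apply: cvgV; [exact: f0|exact: smooth_continuous sf _].
split=> [p Up|v].
  by apply: differentiableV; [exact: smooth_differentiable sf _|exact: f0].
have sfv : smooth_order k U (fun p => -1 * 'D_v f p).
  exact: (smoothZ _ oU (smooth_derive v sf)).
apply: (smooth_order_ext oU _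
  (smooth_orderM oU (smooth_orderM oU IH IH) sfv)) => p Up /=.
rewrite deriveV ?f0 //; last exact/diff_derivable/(smooth_differentiable sf).
by rewrite mulN1r mulrN scaleNr expr2 invfM.
Qed.

Lemma derive_comp_coord E G (I : finType) (e : I -> G) (l : I -> G -> K)
    (u : E -> G) (g : G -> K) p v :
  (forall y, y = \sum_i l i y *: e i) ->
  differentiable u p -> differentiable g (u p) ->
  'D_v (g \o u) p = \sum_i l i ('D_v u p) * 'D_(e i) g (u p).
Proof.
move=> le dp dgp.
rewrite (deriveE _ (differentiable_comp dp dgp)) (diff_comp dp dgp) /=.
rewrite -(deriveE v dp) [in LHS](le ('D_v u p)) linear_sum.
by apply: eq_bigr => i _; rewrite linearZ /= (deriveE _ dgp).
Qed.

(** A finite family of continuous coordinate forms reduces the chain rule to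
    products and sums of scalar functions, so that smoothness of a composite
    follows by induction on the order. *)
Lemma smooth_comp_coord E G (I : finType) (e : I -> G) (l : I -> {linear G -> K})
    (U : set E) (V : set G) (u : E -> G) (g : G -> K) :
  open U -> (forall i, continuous (l i)) ->
  (forall y, y = \sum_i l i y *: e i) -> (forall p, U p -> V (u p)) ->
  smooth U u -> smooth V g -> smooth U (g \o u).
Proof.
move=> oU cl le UV su sg k; elim: k g sg => [|k IH] g sg.
  move=> p Up; apply: continuous_comp; first exact: (smooth_continuous su).
  by apply: (smooth_continuous sg); exact: UV.
have dg p (Up : U p) := smooth_differentiable sg (UV _ Up).
have du p (Up : U p) := smooth_differentiable su Up.
split=> [p Up|v].
  by apply: differentiable_comp; [exact: du|exact: dg].
have sI i : smooth_order k U (fun p => (l i \o 'D_v u) p * ('D_(e i) g \o u) p).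
  apply: smooth_orderM => //; last exact/IH/smooth_derive.
  exact: (smooth_linear_comp oU (cl i) (smooth_derive v su)).
apply: (smooth_order_ext oU _ (smooth_order_sum (index_enum I) oU sI)) => p Up /=.
by rewrite (derive_comp_coord v le (du _ Up) (dg _ Up)).
Qed.

End SmoothCalculus.

(** * Matrix-valued functions *)
Section MatrixCalculus.
Variable K : numFieldType.

(** Taking an entry, named so that it can carry a linear structure. *)
Definition mx_entry p q (i : 'I_p) (j : 'I_q) (M : 'M[K]_(p, q)) : K := M i j.

Lemma mx_entry_is_linear p q (i : 'I_p) (j : 'I_q) : linear (@mx_entry p q i j).
Proof. by move=> a M N; rewrite /mx_entry !mxE. Qed.

HB.instance Definition _ p q (i : 'I_p) (j : 'I_q) :=
  GRing.isLinear.Build K 'M[K]_(p, q) K _ (@mx_entry p q i j)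
    (mx_entry_is_linear i j).

Lemma mx_entry_continuous p q (i : 'I_p) (j : 'I_q) :
  continuous (@mx_entry p q i j).
Proof. exact: coord_continuous. Qed.

(** Smoothness of matrices is reduced to that of entries by writing a matrix as a
    combination of the elementary ones. *)
Lemma smooth_mxP (E : normedModType K) (U : set E) p q (M : E -> 'M[K]_(p, q)) :
  open U ->
  smooth U M <-> forall i j, smooth U (fun x => M x i j).
Proof.
move=> oU; split=> [sM i j|sM].
  pose L : {linear 'M[K]_(p, q) -> K} := @mx_entry p q i j.
  exact: (@smooth_linear_comp K E _ _ U L M oU (@mx_entry_continuous p q i j) sM).
have sMd i j : smooth U (fun x => M x i j *: (delta_mx i j : 'M[K]_(p, q))).
  pose f (c : K) := c *: (delta_mx i j : 'M[K]_(p, q)).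
  have lin : linear f by move=> a c d; rewrite /f scalerDl scalerA.
  pose linM := GRing.isLinear.Build _ _ _ _ _ lin.
  pose L : {linear K -> 'M[K]_(p, q)} := HB.pack f linM.
  apply: (@smooth_linear_comp K E _ _ U L) => //.
  exact: scalel_continuous.
apply: (smooth_ext oU _ (smooth_sum (index_enum _) oU
  (fun i => smooth_sum (index_enum _) oU (sMd i)))) => x _ /=.
by rewrite [RHS]matrix_sum_delta.
Qed.

Lemma smooth_entry (E : normedModType K) (U : set E) p q (M : E -> 'M[K]_(p, q))
    i j :
  open U -> smooth U M -> smooth U (fun x => M x i j).
Proof. by move=> oU /(smooth_mxP _ oU). Qed.

Lemma derive_mxE (E : normedModType K) p q (M : E -> 'M[K]_(p, q)) x v i j :
  differentiable M x -> 'D_v M x i j = 'D_v (fun y => M y i j) x.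
Proof.
move=> dM; have cL := @mx_entry_continuous p q i j.
have dL : differentiable (@mx_entry p q i j) (M x) by exact: linear_differentiable.
rewrite (deriveE _ dM) [RHS](deriveE v (differentiable_comp dM dL)).
by rewrite (diff_comp dM dL) (diff_lin _ cL).
Qed.

End MatrixCalculus.

(** * Curves and their Taylor coefficients *)
Section Curves.
Variable K : numFieldType.

Lemma smooth_id (E : normedModType K) (U : set E) : smooth U id.
Proof.
case=> [|k]; first by move=> p _; exact: cvg_id.
split=> [p _|v]; first by have [] := is_diff_id p.
have -> : 'D_v id = cst v :> (E -> E) by apply/funext => x; rewrite derive_id.
exact: smooth_order_cst.
Qed.

Lemma derive_pair (E F G : normedModType K) (f : E -> F) (g : E -> G) p v :
  differentiable f p -> differentiable g p ->
  'D_v (fun q => (f q, g q)) p = ('D_v f p, 'D_v g p).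
Proof.
move=> df dg; rewrite (deriveE v (differentiable_pair df dg)) diff_pair //.
by rewrite !deriveE.
Qed.

Lemma smooth_pair (E F G : normedModType K) (U : set E) (f : E -> F)
    (g : E -> G) :
  open U -> smooth U f -> smooth U g -> smooth U (fun p => (f p, g p)).
Proof.
move=> oU sf sg k; move: {sf}(sf k) {sg}(sg k); elim: k f g => [|k IH] f g /=.
  by move=> cf cg p Up; apply: cvg_pair; [exact: cf|exact: cg].
move=> [df sf] [dg sg]; split=> [p Up|v].
  by apply: differentiable_pair; [exact: df|exact: dg].
apply: (smooth_order_ext oU _ (IH _ _ (sf v) (sg v))) => p Up.
by rewrite derive_pair //; [exact: df|exact: dg].
Qed.

Lemma smooth_derive1 (F : normedModType K) (O : set K) (u : K -> F) :
  smooth O u -> smooth O (derive1 u).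
Proof.
move=> su; have -> : derive1 u = 'D_1 u by apply/funext => x; rewrite derive1E.
exact: smooth_derive.
Qed.

Lemma derive1_ext (F : normedModType K) (O : set K) (u v : K -> F) z :
  open O -> O z -> (forall t, O t -> u t = v t) -> derive1 u z = derive1 v z.
Proof.
move=> oO Oz uv; rewrite !derive1E; apply: near_eq_derive.
by apply: filterS uv _; exact: open_nbhs_nbhs.
Qed.

Section OpenDomain.
Variables (O : set K) (oO : open O).
Implicit Types u v : K -> K.

Let der u z : smooth O u -> O z -> derivable u z 1.
Proof. by move=> su Oz; exact/diff_derivable/(smooth_differentiable su). Qed.

Lemma derive1_add u v z : smooth O u -> smooth O v -> O z ->
  derive1 (u \+ v) z = derive1 u z + derive1 v z.
Proof. move=> su sv Oz; rewrite !derive1E [LHS]deriveD; [by []|exact: der..]. Qed.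

Lemma derive1_sub u v z : smooth O u -> smooth O v -> O z ->
  derive1 (u \- v) z = derive1 u z - derive1 v z.
Proof. move=> su sv Oz; rewrite !derive1E [LHS]deriveB; [by []|exact: der..]. Qed.

Lemma derive1_mul u v z : smooth O u -> smooth O v -> O z ->
  derive1 (u \* v) z = derive1 u z * v z + u z * derive1 v z.
Proof.
move=> su sv Oz; rewrite !derive1E [LHS]deriveM; [|exact: der..].
by rewrite addrC [v z *: _]mulrC.
Qed.

Lemma derive1_scale c u z : smooth O u -> O z ->
  derive1 (fun t => c * u t) z = c * derive1 u z.
Proof. by move=> su Oz; rewrite derive1Ml; [by []|exact: der]. Qed.

Lemma derive1_inv u z : smooth O u -> O z -> u z != 0 ->
  derive1 (fun t => (u t)^-1) z = - derive1 u z / u z ^+ 2.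
Proof.
move=> su Oz u0; rewrite !derive1E deriveV; [|by []|exact: der].
by rewrite scaleNr mulNr; congr (- _); rewrite mulrC.
Qed.

Lemma derive1_sum I (r : seq I) (u : I -> K -> K) z :
  (forall i, smooth O (u i)) -> O z ->
  derive1 (fun t => \sum_(i <- r) u i t) z = \sum_(i <- r) derive1 (u i) z.
Proof.
move=> su Oz; elim: r => [|i r IH].
  rewrite big_nil -[RHS](derive1_cst (0 : K) z).
  by apply: (derive1_ext oO Oz) => t _; rewrite big_nil.
rewrite big_cons -IH -derive1_add //; last exact: smooth_sum.
by apply: (derive1_ext oO Oz) => t _; rewrite big_cons.
Qed.

Lemma derive1_exp u j z : smooth O u -> O z ->
  derive1 (fun t => u t ^+ j) z = j%:R * u z ^+ j.-1 * derive1 u z.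
Proof.
move=> su Oz; rewrite !derive1E.
by have := @deriveX _ _ u j z 1 (der su Oz); rewrite exprfctE => ->.
Qed.

Lemma derive1_mxE p q (w : K -> 'M[K]_(p, q)) i j z : smooth O w -> O z ->
  derive1 w z i j = derive1 (fun t => w t i j) z.
Proof.
move=> sw Oz; rewrite !derive1E derive_mxE //.
exact: smooth_differentiable sw Oz.
Qed.

Lemma derive1n_mxE p q (w : K -> 'M[K]_(p, q)) i j k z : smooth O w -> O z ->
  derive1n k w z i j = derive1n k (fun t => w t i j) z.
Proof.
move=> sw; have sk l : smooth O (derive1n l w).
  by elim: l => // l IH; rewrite derive1nS; exact: smooth_derive1.
elim: k z => // k IH z Oz; rewrite !derive1nS derive1_mxE //.
exact: (derive1_ext oO Oz).
Qed.

(** The Taylor polynomial of order [k] of [u] at [z0] is [c (z - z0) ^ k].  The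
    recursion on derivatives involves no remainder estimate, and so makes sense
    over any field with a derivative. *)
Fixpoint lead (z0 : K) k (u : K -> K) (c : K) : Prop :=
  if k is k'.+1 then u z0 = 0 /\ lead z0 k' (derive1 u) (k%:R * c) else u z0 = c.

Variables (z0 : K) (Oz0 : O z0).

Lemma lead_ext k u v c : (forall z, O z -> u z = v z) ->
  lead z0 k u c -> lead z0 k v c.
Proof.
elim: k u v c => [|k IH] u v c uv /=; first by rewrite uv.
rewrite uv // => -[-> uc]; split => //; apply: IH uc => z Oz.
exact: (derive1_ext oO Oz).
Qed.

Lemma leadD k u v c d : smooth O u -> smooth O v ->
  lead z0 k u c -> lead z0 k v d -> lead z0 k (u \+ v) (c + d).
Proof.
elim: k u v c d => [|k IH] u v c d su sv /=; first by move=> -> ->.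
move=> [-> uc] [-> vd]; rewrite addr0; split=> //; rewrite mulrDr.
have := IH _ _ _ _ (smooth_derive1 su) (smooth_derive1 sv) uc vd.
by apply: lead_ext => z Oz; rewrite (derive1_add su sv Oz).
Qed.

Lemma leadW k u c : lead z0 k.+1 u c -> lead z0 k u 0.
Proof.
elim: k u c => [|k IH] u c; first by case.
by move=> [u0 /IH uc]; split; rewrite ?mulr0.
Qed.

Lemma lead_lt j k u c : (j < k)%N -> lead z0 k u c -> lead z0 j u 0.
Proof.
elim: k c => // k IH c; rewrite ltnS leq_eqVlt => /predU1P[-> /leadW //|jk].
by move=> /leadW /(IH _ jk).
Qed.

(** Leading Taylor terms multiply.  The induction runs on the total order, the
    product rule lowering one of the two orders at each step. *)
Lemma leadM k l u v c d : smooth O u -> smooth O v ->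
  lead z0 k u c -> lead z0 l v d -> lead z0 (k + l) (u \* v) (c * d).
Proof.
move: {2}(k + l)%N (erefl (k + l)%N) => N.
elim: N k l u v c d => [|N IH] k l u v c d.
  case: k => //; case: l => // _ su sv /= -> ->; exact: erefl.
move=> klN su sv uc vd; rewrite klN.
have su' := smooth_derive1 su; have sv' := smooth_derive1 sv.
have uv0 : u z0 * v z0 = 0.
  case: k klN uc => [|k] klN; last by case=> ->; rewrite mul0r.
  by case: l klN vd => // l klN [-> _]; rewrite mulr0.
split=> //.
have H1 : lead z0 N (derive1 u \* v) (k%:R * c * d).
  case: k klN uc => [|k] klN uc; last first.
    have NE : N = (k + l)%N by case: klN.
    by rewrite NE; case: uc => _ uc; apply: (IH).
  rewrite mul0r mul0r -(mulr0 (derive1 u z0)).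
  rewrite add0n in klN; rewrite klN in vd.
  by have := IH 0%N N _ _ _ _ (erefl _) su' sv (erefl _) (leadW vd).
have H2 : lead z0 N (u \* derive1 v) (c * (l%:R * d)).
  case: l klN vd => [|l] klN vd; last first.
    have NE : N = (k + l)%N by move: klN; rewrite addnS => -[].
    by rewrite NE; case: vd => _ vd; apply: (IH).
  rewrite mul0r mulr0 -(mul0r (derive1 v z0)).
  rewrite addn0 in klN; rewrite klN in uc.
  by have := IH N 0%N _ _ _ _ (addn0 _) su sv' (leadW uc) (erefl _); rewrite addn0.
have -> : N.+1%:R * (c * d) = k%:R * c * d + c * (l%:R * d).
  by rewrite -klN natrD; ring.
apply: lead_ext (leadD _ _ H1 H2) => [z Oz||].
- by rewrite derive1_mul.
- exact: smoothM.
- exact: smoothM.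
Qed.

Lemma leadZ k a u c : smooth O u -> lead z0 k u c ->
  lead z0 k (fun z => a * u z) (a * c).
Proof. by move=> su; apply: (@leadM 0) => //; exact: smooth_cst. Qed.

Lemma leadB k u v c d : smooth O u -> smooth O v ->
  lead z0 k u c -> lead z0 k v d -> lead z0 k (u \- v) (c - d).
Proof.
move=> su sv uc vd; rewrite -[- d]mulN1r.
have := leadD su (smoothZ (-1) oO sv) uc (leadZ (-1) sv vd).
by apply: lead_ext => z _ /=; rewrite mulN1r.
Qed.

Lemma lead_cst0 k : lead z0 k (fun=> 0) 0.
Proof.
elim: k => // k IH; split=> //; rewrite mulr0; apply: lead_ext IH => z _.
by rewrite derive1_cst.
Qed.

Lemma lead_sum k I (r : seq I) (u : I -> K -> K) (c : I -> K) :
  (forall i, smooth O (u i)) -> (forall i, lead z0 k (u i) (c i)) ->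
  lead z0 k (fun z => \sum_(i <- r) u i z) (\sum_(i <- r) c i).
Proof.
move=> su uc; elim: r => [|i r IH].
  by rewrite big_nil; apply: lead_ext (lead_cst0 k) => z _; rewrite big_nil.
rewrite big_cons; have := leadD (su i) (smooth_sum r oO su) (uc i) IH.
by apply: lead_ext => z _; rewrite big_cons.
Qed.

Lemma lead_derive1n k u c : (forall j, (j < k)%N -> derive1n j u z0 = 0) ->
  derive1n k u z0 = k`!%:R * c -> lead z0 k u c.
Proof.
elim: k u c => [|k IH] u c u0 uk /=; first by rewrite -[RHS]mul1r.
split; first exact: (u0 0%N).
apply: IH => [j jk|]; first by rewrite -derive1Sn u0.
by rewrite -derive1Sn uk factS natrM; ring.
Qed.

End OpenDomain.
End Curves.

(** * Functions along the graph of a curve *)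
Section AlongCurves.
Variables (K : numFieldType) (m : nat).
Local Notation V := 'cV[K]_m.
Implicit Types (g : K * V -> K) (w : K -> V).

Definition jet_basis (o : unit + 'I_m) : K * V :=
  match o with inl _ => (1, 0) | inr i => (0, delta_mx i 0) end.

Definition jet_coord (o : unit + 'I_m) (p : K * V) : K :=
  match o with inl _ => p.1 | inr i => p.2 i 0 end.

Lemma jet_coord_is_linear o : linear (jet_coord o).
Proof. by case: o => [_|i] a p q //=; rewrite !mxE. Qed.

HB.instance Definition _ o :=
  GRing.isLinear.Build K (K * V)%type K *%R (jet_coord o) (jet_coord_is_linear o).

Lemma jet_coord_continuous o : continuous (jet_coord o).
Proof.
move=> p; case: o => [u|i]; first exact: cvg_fst.
apply: (@continuous_comp _ _ _ snd (fun w : V => w i 0)); first exact: cvg_snd.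
exact: coord_continuous.
Qed.

Lemma jet_coord_basis p : p = \sum_o jet_coord o p *: jet_basis o.
Proof.
rewrite big_sumType /= (big_pred1 tt) /=; last by case.
case: p => [z w] /=; rewrite [w in LHS]matrix_sum_delta.
have -> : \sum_i w i 0 *: ((0, delta_mx i 0) : K * V) =
    (0, \sum_i w i 0 *: delta_mx i 0).
  elim/big_rec2: _ => // i y1 y2 _ ->.
  by congr pair; rewrite /= scaler0 add0r.
congr pair; rewrite /= ?scaler0 ?add0r ?addr0 ?[z *: 1]mulr1 //.
by apply: eq_bigr => i _; rewrite big_ord1.
Qed.

Variables (U : set (K * V)) (O : set K) (oO : open O).

Definition graph w z := (z, w z).

Lemma smooth_graph w : smooth O w -> smooth O (graph w).
Proof. by move=> sw; apply: smooth_pair => //; exact: smooth_id. Qed.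

Lemma smooth_along g w : smooth U g -> smooth O w ->
  (forall z, O z -> U (graph w z)) -> smooth O (g \o graph w).
Proof.
move=> sg sw wU.
exact: (@smooth_comp_coord _ _ _ _ _ (fun o => jet_coord o : {linear _ -> _})
  _ _ _ _ oO jet_coord_continuous jet_coord_basis wU (smooth_graph sw) sg).
Qed.

Lemma derive_dir g p (d : V) : differentiable g p ->
  'D_(0, d) g p = \sum_i 'D_(0, delta_mx i 0) g p * d i 0.
Proof.
move=> dg; rewrite deriveE // [X in 'd g p X]jet_coord_basis linear_sum.
rewrite big_sumType /= (big_pred1 tt) /=; last by case.
rewrite scale0r linear0 add0r; apply: eq_bigr => i _.
by rewrite linearZ /= deriveE // mulrC.
Qed.

Lemma derive1_along g w z : smooth U g -> smooth O w ->
  (forall z, O z -> U (graph w z)) -> O z ->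
  derive1 (g \o graph w) z = 'D_(1, 0) g (graph w z) +
    \sum_i 'D_(0, delta_mx i 0) g (graph w z) * derive1 (fun t => w t i 0) z.
Proof.
move=> sg sw wU Oz.
have dg : differentiable g (graph w z) by apply: smooth_differentiable sg _; exact: wU.
have dw : differentiable (graph w) z := smooth_differentiable (smooth_graph sw) Oz.
have dw' : differentiable w z := smooth_differentiable sw Oz.
rewrite derive1E (derive_comp_coord _ jet_coord_basis dw dg) derive_pair //.
rewrite derive_id big_sumType /= (big_pred1 tt) /=; last by case.
rewrite mul1r; congr +%R; apply: eq_bigr => i _.
by rewrite mulrC derive1E derive_mxE.
Qed.

Variables (z0 : K) (Oz0 : O z0).

Definition curve_in w := smooth O w /\ forall z, O z -> U (graph w z).

Lemma smooth_curve_in g w : smooth U g -> curve_in w -> smooth O (g \o graph w).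
Proof. by move=> sg [sw wU]; exact: smooth_along. Qed.

Let smooth_dentry w i : smooth O w -> smooth O (derive1 (fun t => w t i 0)).
Proof. by move=> sw; exact/smooth_derive1/smooth_entry. Qed.

Lemma derive1_along_sub g w w' z : smooth U g -> curve_in w -> curve_in w' -> O z ->
  derive1 ((g \o graph w) \- (g \o graph w')) z =
  ('D_(1, 0) g \o graph w) z - ('D_(1, 0) g \o graph w') z +
  \sum_i ((('D_(0, delta_mx i 0) g \o graph w) z -
            ('D_(0, delta_mx i 0) g \o graph w') z) * derive1 (fun t => w t i 0) z +
          ('D_(0, delta_mx i 0) g \o graph w') z *
            derive1 ((fun t => w t i 0) \- (fun t => w' t i 0)) z).
Proof.
move=> sg cw cw' Oz; have [sw wU] := cw; have [sw' w'U] := cw'.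
rewrite (derive1_sub (smooth_curve_in sg cw) (smooth_curve_in sg cw') Oz).
rewrite (derive1_along sg sw wU Oz) (derive1_along sg sw' w'U Oz).
rewrite opprD addrACA; congr +%R; rewrite -sumrB; apply: eq_bigr => i _.
rewrite (derive1_sub (smooth_entry i 0 oO sw) (smooth_entry i 0 oO sw') Oz) /=.
ring.
Qed.

Let lead_along_sub_step k g w w' (d : V) :
  smooth U g -> curve_in w -> curve_in w' ->
  (forall h, smooth U h -> lead z0 k ((h \o graph w) \- (h \o graph w')) 0) ->
  (forall i, lead z0 k (derive1 ((fun z => w z i 0) \- (fun z => w' z i 0))) (d i 0)) ->
  lead z0 k (derive1 ((g \o graph w) \- (g \o graph w')))
    (\sum_i 'D_(0, delta_mx i 0) g (graph w' z0) * d i 0).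
Proof.
move=> sg cw cw' IH wd.
have sgv v w1 : curve_in w1 -> smooth O ('D_v g \o graph w1).
  by move=> cw1; apply: smooth_curve_in => //; exact: smooth_derive.
have [[sw _] [sw' _]] := (cw, cw').
pose u1 i := ('D_(0, delta_mx i 0) g \o graph w) \- ('D_(0, delta_mx i 0) g \o graph w').
have su1 i : smooth O (u1 i) by apply: smoothB => //; exact: sgv.
pose u2 i := derive1 ((fun z => w z i 0) \- (fun z => w' z i 0)).
have su2 i : smooth O (u2 i) by apply/smooth_derive1/smoothB => //; exact: smooth_entry.
have L i : lead z0 k ((u1 i \* derive1 (fun t => w t i 0)) \+
    (('D_(0, delta_mx i 0) g \o graph w') \* u2 i))
    (0 * derive1 (fun t => w t i 0) z0 + 'D_(0, delta_mx i 0) g (graph w' z0) * d i 0).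
  apply: (leadD oO Oz0).
  - by apply: smoothM => //; exact: smooth_dentry.
  - by apply: smoothM => //; exact: sgv.
  - have H := IH _ (smooth_derive ((0, delta_mx i 0) : K * V) sg).
    have := @leadM _ _ oO _ Oz0 k 0 _ _ _ _ (su1 i) (smooth_dentry i sw) H erefl.
    by rewrite addn0.
  - have := @leadM _ _ oO _ Oz0 0 k _ _ _ _ (sgv (0, delta_mx i 0) _ cw') (su2 i) erefl (wd i).
    by rewrite add0n.
have sL i : smooth O ((u1 i \* derive1 (fun t => w t i 0)) \+
    (('D_(0, delta_mx i 0) g \o graph w') \* u2 i)).
  apply: smoothD => //; apply: smoothM => //; first exact: smooth_dentry.
  exact: sgv.
have -> : \sum_i 'D_(0, delta_mx i 0) g (graph w' z0) * d i 0 =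
    0 + \sum_i (0 * derive1 (fun t => w t i 0) z0 +
                'D_(0, delta_mx i 0) g (graph w' z0) * d i 0).
  by rewrite add0r; apply: eq_bigr => i _; rewrite mul0r add0r.
have H1 := IH _ (smooth_derive ((1, 0) : K * V) sg).
have H2 := lead_sum oO Oz0 (index_enum _) sL L.
have sH1 : smooth O (('D_(1, 0) g \o graph w) \- ('D_(1, 0) g \o graph w')).
  by apply: smoothB => //; exact: sgv.
apply: (lead_ext oO Oz0 _ (leadD oO Oz0 sH1 (smooth_sum _ oO sL) H1 H2)).
by move=> z Oz; rewrite derive1_along_sub.
Qed.

Lemma lead_along_sub0 k g w w' : smooth U g -> curve_in w -> curve_in w' ->
  (forall i, lead z0 k ((fun z => w z i 0) \- (fun z => w' z i 0)) 0) ->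
  lead z0 k ((g \o graph w) \- (g \o graph w')) 0.
Proof.
elim: k g => [|k IH] g sg cw cw' ww'.
  rewrite /= /graph; have -> : w z0 = w' z0; last by rewrite subrr.
  by apply/colP => i; have /= /subr0_eq := ww' i.
split.
  rewrite /= /graph; have -> : w z0 = w' z0; last by rewrite subrr.
  by apply/colP => i; have /= [/subr0_eq] := ww' i.
have -> : k.+1%:R * 0 = \sum_i 'D_(0, delta_mx i 0) g (graph w' z0) * (0 : V) i 0.
  by rewrite mulr0 big1 // => i _; rewrite mxE mulr0.
apply: lead_along_sub_step => //.
- by move=> h sh; apply: IH => // i; exact: leadW (ww' i).
- by move=> i; rewrite mxE; case: (ww' i); rewrite mulr0.
Qed.

(** First order Taylor expansion in the dependent variable: only the linear
    term of [g] contributes to the first coefficient that differs. *)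
Lemma lead_along_sub k g w w' (d : V) : smooth U g -> curve_in w -> curve_in w' ->
  (forall i, lead z0 k.+1 ((fun z => w z i 0) \- (fun z => w' z i 0)) (d i 0)) ->
  lead z0 k.+1 ((g \o graph w) \- (g \o graph w')) ('D_(0, d) g (graph w' z0)).
Proof.
move=> sg cw cw' ww'; split.
  rewrite /= /graph; have -> : w z0 = w' z0; last by rewrite subrr.
  by apply/colP => i; have /= [/subr0_eq] := ww' i.
have -> : k.+1%:R * 'D_(0, d) g (graph w' z0) =
    \sum_i 'D_(0, delta_mx i 0) g (graph w' z0) * (k.+1%:R *: d) i 0.
  rewrite derive_dir; last by case: cw' => _ /(_ _ Oz0); exact: smooth_differentiable.
  by rewrite mulr_sumr; apply: eq_bigr => i _; rewrite mxE mulrCA.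
apply: lead_along_sub_step => //.
- by move=> h sh; apply: lead_along_sub0 => // i; exact: leadW (ww' i).
- by move=> i; rewrite mxE; case: (ww' i).
Qed.

Section SecondDifference.
Variables (p A B : K -> V) (a b : nat) (v : V).
Hypotheses (sp : smooth O p) (sA : smooth O A) (sB : smooth O B).
Hypotheses (pU : curve_in p) (pAU : curve_in (p \+ A)).
Hypotheses (pBU : curve_in (p \+ B)) (pABU : curve_in (p \+ A \+ B)).
Hypotheses (leadA : forall i, lead z0 a.+1 (fun z => A z i 0) (v i 0)).
Hypotheses (leadB : forall i, lead z0 b.+1 (fun z => B z i 0) (v i 0)).

Definition second_difference g :=
  ((g \o graph (p \+ A \+ B)) \- (g \o graph (p \+ A))) \-
  ((g \o graph (p \+ B)) \- (g \o graph p)).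

Let sdiff g : smooth U g -> smooth O (second_difference g).
Proof. by move=> sg; do !apply: smoothB => //; exact: smooth_curve_in. Qed.

Let dB g := (g \o graph (p \+ A \+ B)) \- (g \o graph (p \+ A)).
Let dA g := (g \o graph (p \+ A \+ B)) \- (g \o graph (p \+ B)).

Let sdB g : smooth U g -> smooth O (dB g).
Proof. by move=> sg; apply: smoothB => //; exact: smooth_curve_in. Qed.

Let sdA g : smooth U g -> smooth O (dA g).
Proof. by move=> sg; apply: smoothB => //; exact: smooth_curve_in. Qed.

Let A0 : A z0 = 0.
Proof. by apply/colP => i; rewrite mxE; case: (leadA i). Qed.

Let B0 : B z0 = 0.
Proof. by apply/colP => i; rewrite mxE; case: (leadB i). Qed.

Let lead_dB g : smooth U g -> lead z0 b.+1 (dB g) ('D_(0, v) g (graph p z0)).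
Proof.
move=> sg; have -> : graph p z0 = graph (p \+ A) z0 by rewrite /graph /= A0 addr0.
apply: lead_along_sub => // i; apply: (lead_ext oO Oz0 _ (leadB i)) => z Oz /=.
by rewrite !mxE; ring.
Qed.

Let lead_dA g : smooth U g -> lead z0 a.+1 (dA g) ('D_(0, v) g (graph p z0)).
Proof.
move=> sg; have -> : graph p z0 = graph (p \+ B) z0 by rewrite /graph /= B0 addr0.
apply: lead_along_sub => // i; apply: (lead_ext oO Oz0 _ (leadA i)) => z Oz /=.
by rewrite !mxE; ring.
Qed.

Let D i : K * V := (0, delta_mx i 0).

Let derive1_second_difference g z : smooth U g -> O z ->
  derive1 (second_difference g) z = second_difference ('D_(1, 0) g) z +
  \sum_i (second_difference ('D_(D i) g) z * derive1 (fun t => p t i 0) z +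
    (derive1 (fun t => A t i 0) z * dB ('D_(D i) g) z +
     derive1 (fun t => B t i 0) z * dA ('D_(D i) g) z)).
Proof.
move=> sg Oz; rewrite /second_difference.
have sc w : curve_in w -> smooth O (g \o graph w) by exact: smooth_curve_in.
rewrite (@derive1_sub _ O) //; [|by apply: smoothB => //; exact: sc..].
rewrite !(@derive1_sub _ O) //; [|exact: sc..].
have along w : curve_in w -> _ := fun cw => derive1_along sg cw.1 cw.2 Oz.
rewrite !along // /dB /dA /D /=.
set S1 := \sum_i _; set S2 := \sum_i _; set S3 := \sum_i _; set S4 := \sum_i _.
set S5 := \sum_i _.
have <- : S1 - S2 - (S3 - S4) = S5; last by ring.
rewrite /S1 /S2 /S3 /S4 /S5 -!sumrB; apply: eq_bigr => i _.
have entD (w w' : K -> V) : smooth O w -> smooth O w' ->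
    derive1 (fun t => (w \+ w') t i 0) z =
    derive1 (fun t => w t i 0) z + derive1 (fun t => w' t i 0) z.
  move=> sw sw'.
  rewrite -(derive1_add (smooth_entry i 0 oO sw) (smooth_entry i 0 oO sw') Oz).
  by apply: (derive1_ext oO Oz) => t _; rewrite /= mxE.
have spA := smoothD oO sp sA.
rewrite (entD (p \+ A) B) // (entD p A) // (entD p B) //; ring.
Qed.

Let sdA' i : smooth O (derive1 (fun t => A t i 0)).
Proof. exact: smooth_dentry. Qed.

Let sdB' i : smooth O (derive1 (fun t => B t i 0)).
Proof. exact: smooth_dentry. Qed.

(** The terms that make the second difference nonzero: one perturbation is
    differentiated, the other one is felt through the coefficient. *)
Let cross g i : smooth U g ->
  lead z0 (a + b).+1 ((derive1 (fun t => A t i 0) \* dB ('D_(D i) g)) \+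
                      (derive1 (fun t => B t i 0) \* dA ('D_(D i) g)))
    (a.+1%:R * v i 0 * 'D_(0, v) ('D_(D i) g) (graph p z0) +
     b.+1%:R * v i 0 * 'D_(0, v) ('D_(D i) g) (graph p z0)).
Proof.
move=> sg; have sDg := smooth_derive (D i) sg.
apply: (leadD oO Oz0) => //.
- by apply: smoothM => //; exact: sdB.
- by apply: smoothM => //; exact: sdA.
- by rewrite -addnS; apply: (leadM oO Oz0) => //; [exact: sdB|case: (leadA i)|exact: lead_dB].
- rewrite addnC -addnS; apply: (leadM oO Oz0) => //; first exact: sdA.
    by case: (leadB i).
  exact: lead_dA.
Qed.

Let lead_second_difference0 N g : smooth U g -> (N < a.+1 + b.+1)%N ->
  lead z0 N (second_difference g) 0.
Proof.
have v0 h : second_difference h z0 = 0.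
  by rewrite /second_difference /graph /= A0 B0 !addr0 !subrr.
elim: N g => [|N IH] g sg Nab; first exact: v0.
split; first exact: v0.
have Nab' : (N < a.+1 + b.+1)%N := ltnW Nab.
have L i : lead z0 N ((second_difference ('D_(D i) g) \* derive1 (fun t => p t i 0)) \+
   ((derive1 (fun t => A t i 0) \* dB ('D_(D i) g)) \+
    (derive1 (fun t => B t i 0) \* dA ('D_(D i) g)))) 0.
  have sDg := smooth_derive (D i) sg.
  have sp' : smooth O (derive1 (fun t => p t i 0)) by exact: smooth_dentry.
  rewrite -[X in lead _ _ _ X](addr0 0); apply: (leadD oO Oz0) => //.
  - by apply: smoothM => //; exact: sdiff.
  - by apply: smoothD => //; apply: smoothM => //; [exact: sdB|exact: sdA].
  - rewrite -[X in lead _ _ _ X](mul0r (derive1 (fun t => p t i 0) z0)) -[N]addn0.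
    by apply: (leadM oO Oz0) => //; [exact: sdiff|exact: IH].
  - by apply: lead_lt (cross i sg); move: Nab; rewrite addSn addnS ltnS.
have sL i : smooth O ((second_difference ('D_(D i) g) \* derive1 (fun t => p t i 0)) \+
   ((derive1 (fun t => A t i 0) \* dB ('D_(D i) g)) \+
    (derive1 (fun t => B t i 0) \* dA ('D_(D i) g)))).
  have sDg := smooth_derive (D i) sg.
  apply: smoothD => //; first by apply: smoothM => //; [exact: sdiff|exact: smooth_dentry].
  by apply: smoothD => //; apply: smoothM => //; [exact: sdB|exact: sdA].
have -> : N.+1%:R * 0 = 0 + \sum_(i < m) 0 :> K by rewrite big1_eq addr0 mulr0.
have H1 := IH _ (smooth_derive ((1, 0) : K * V) sg) Nab'.
have sH1 := sdiff (smooth_derive ((1, 0) : K * V) sg).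
have H2 := lead_sum oO Oz0 (index_enum _) sL L.
apply: (lead_ext oO Oz0 _ (leadD oO Oz0 sH1 (smooth_sum _ oO sL) H1 H2)).
by move=> z Oz; rewrite derive1_second_difference.
Qed.

(** Perturbations of orders [a + 1] and [b + 1] in the same direction [v]
    interact first at order [a + b + 2], and only through the second derivative
    of [g] along [v]. *)
Lemma lead_second_difference g : open U -> smooth U g ->
  lead z0 (a.+1 + b.+1) (second_difference g)
    ('D_(0, v) ('D_(0, v) g) (graph p z0)).
Proof.
move=> oU sg; rewrite addSn; split.
  by rewrite /second_difference /graph /= A0 B0 !addr0 !subrr.
rewrite addnS.
pose c i := 'D_(0, v) ('D_(D i) g) (graph p z0).
have Up : U (graph p z0) by case: pU => _; exact.
have L i : lead z0 (a + b).+1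
   ((second_difference ('D_(D i) g) \* derive1 (fun t => p t i 0)) \+
   ((derive1 (fun t => A t i 0) \* dB ('D_(D i) g)) \+
    (derive1 (fun t => B t i 0) \* dA ('D_(D i) g))))
   (0 + (a.+1%:R * v i 0 * c i + b.+1%:R * v i 0 * c i)).
  have sDg := smooth_derive (D i) sg.
  have sp' : smooth O (derive1 (fun t => p t i 0)) by exact: smooth_dentry.
  apply: (leadD oO Oz0) => //.
  - by apply: smoothM => //; exact: sdiff.
  - by apply: smoothD => //; apply: smoothM => //; [exact: sdB|exact: sdA].
  - rewrite -[X in lead _ _ _ X](mul0r (derive1 (fun t => p t i 0) z0)) -[(a + b).+1]addn0.
    apply: (leadM oO Oz0) => //; first exact: sdiff.
    by apply: lead_second_difference0 => //; rewrite addSn addnS.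
  - exact: cross.
have sL i : smooth O ((second_difference ('D_(D i) g) \* derive1 (fun t => p t i 0)) \+
   ((derive1 (fun t => A t i 0) \* dB ('D_(D i) g)) \+
    (derive1 (fun t => B t i 0) \* dA ('D_(D i) g)))).
  have sDg := smooth_derive (D i) sg.
  apply: smoothD => //; first by apply: smoothM => //; [exact: sdiff|exact: smooth_dentry].
  by apply: smoothD => //; apply: smoothM => //; [exact: sdB|exact: sdA].
have Dvg : 'D_(0, v) ('D_(0, v) g) (graph p z0) = \sum_i v i 0 * c i.
  pose h q := \sum_i v i 0 * 'D_(D i) g q.
  have -> : 'D_(0, v) ('D_(0, v) g) (graph p z0) = 'D_(0, v) h (graph p z0).
    apply: near_eq_derive; apply: filterS (open_nbhs_nbhs (conj oU Up)) => q Uq.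
    rewrite derive_dir; last exact: smooth_differentiable sg Uq.
    by apply: eq_bigr => i _; rewrite mulrC.
  have dDg i : derivable ('D_(D i) g) (graph p z0) (0, v).
    exact: diff_derivable (smooth_differentiable (smooth_derive (D i) sg) Up).
  have -> : h = \sum_i (v i 0 \*: 'D_(D i) g) :> (K * V -> K).
    by apply/funext => q; rewrite fct_sumE.
  rewrite derive_sum => [|i]; last by apply: derivableZ; exact: dDg.
  by apply: eq_bigr => i _; rewrite deriveZ //; exact: dDg.
have -> : (a + b).+2%:R * 'D_(0, v) ('D_(0, v) g) (graph p z0) =
    0 + \sum_i (0 + (a.+1%:R * v i 0 * c i + b.+1%:R * v i 0 * c i)).
  rewrite add0r Dvg mulr_sumr; apply: eq_bigr => i _.
  have -> : (a + b).+2%:R = a.+1%:R + b.+1%:R :> K by rewrite -natrD addSn addnS.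
  ring.
have H1 : lead z0 (a + b).+1 (second_difference ('D_(1, 0) g)) 0.
  apply: lead_second_difference0; first exact: smooth_derive.
  by rewrite addSn addnS.
have sH1 := sdiff (smooth_derive ((1, 0) : K * V) sg).
have H2 := lead_sum oO Oz0 (index_enum _) sL L.
apply: (lead_ext oO Oz0 _ (leadD oO Oz0 sH1 (smooth_sum _ oO sL) H1 H2)).
by move=> z Oz; rewrite derive1_second_difference.
Qed.

End SecondDifference.
End AlongCurves.

(** * Polynomial curves with a prescribed jet *)
Section JetCurves.
Variables (K : numFieldType) (m : nat) (z0 : K).
Local Notation V := 'cV[K]_m.

Lemma smooth_horner_shift (U : set K) (p : {poly K}) :
  open U -> smooth U (fun z => p.[z - z0]).
Proof.
move=> oU; have sid : smooth U (fun z : K => z - z0).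
  exact: smoothD oU (smooth_id U) (smooth_cst U (- z0)).
elim/poly_ind: p => [|p c IH].
  by apply: (smooth_ext oU _ (smooth_cst U (0 : K))) => z _; rewrite horner0.
apply: (smooth_ext oU _ (smoothD oU (smoothM oU IH sid) (smooth_cst U c))) => z _.
by rewrite /= hornerMXaddC.
Qed.

Lemma derive1_horner_shift (p : {poly K}) :
  derive1 (fun z => p.[z - z0]) = fun z => p^`()%R.[z - z0].
Proof.
have oT : open [set: K] := openT.
have sid : smooth setT (fun z : K => z - z0).
  exact: smoothD oT (smooth_id setT) (smooth_cst setT (- z0)).
have did z : derive1 (fun z : K => z - z0) z = 1.
  rewrite (@derive1_add _ setT id (cst (- z0))) //; last exact: smooth_cst.
    by rewrite derive1_cst addr0 derive1E derive_id.
  exact: smooth_id.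
apply/funext => z; elim/poly_ind: p => [|p c IH].
  rewrite deriv0 horner0 -[RHS](derive1_cst (0 : K) z).
  by apply: (derive1_ext oT) => // t _; rewrite horner0.
have -> : (fun t => (p * 'X + c%:P).[t - z0]) =
    ((fun t => p.[t - z0]) \* (fun t => t - z0)) \+ cst c.
  by apply/funext => t; rewrite hornerMXaddC.
have sp := smooth_horner_shift p oT.
rewrite (@derive1_add _ setT) //; [|exact: smoothM|exact: smooth_cst].
rewrite derive1_cst addr0 (@derive1_mul _ setT) // IH did derivMXaddC.
by rewrite mulr1 !hornerE addrC.
Qed.

Lemma derive1n_horner_shift (p : {poly K}) j :
  derive1n j (fun z => p.[z - z0]) = fun z => p^`(j)%R.[z - z0].
Proof.
elim: j => [|j IH]; first by rewrite derivn0.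
by rewrite derive1nS IH derive1_horner_shift derivnS.
Qed.

Definition jet_poly N (u : nat -> K) : {poly K} :=
  \poly_(j < N.+1) (u j / j`!%:R).

Lemma jet_poly_derive1n N (u : nat -> K) j : (j <= N)%N ->
  derive1n j (fun z => (jet_poly N u).[z - z0]) z0 = u j.
Proof.
move=> jN; rewrite derive1n_horner_shift subrr horner_coef0 coef_derivn addn0.
rewrite ffactnn coef_poly ltnS jN -[LHS]mulr_natr divfK //.
by rewrite pnatr_eq0 -lt0n fact_gt0.
Qed.

Definition jet_curve N (u : nat -> V) (z : K) : V :=
  \col_i (jet_poly N (fun j => u j i 0)).[z - z0].

Lemma jet_curve_entry N u i :
  (fun z => jet_curve N u z i 0) = fun z => (jet_poly N (fun j => u j i 0)).[z - z0].
Proof. by apply/funext => z; rewrite mxE. Qed.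

Lemma smooth_jet_curve (U : set K) N u : open U -> smooth U (jet_curve N u).
Proof.
move=> oU; apply/(smooth_mxP _ oU) => i j; rewrite ord1 jet_curve_entry.
exact: smooth_horner_shift.
Qed.

Lemma derive1n_jet_curve N u j : (j <= N)%N -> derive1n j (jet_curve N u) z0 = u j.
Proof.
move=> jN; apply/colP => i.
rewrite (derive1n_mxE openT i 0 j (smooth_jet_curve N u openT)) //.
by rewrite jet_curve_entry jet_poly_derive1n.
Qed.

Lemma jet_curve0 N u : jet_curve N u z0 = u 0%N.
Proof. exact: (@derive1n_jet_curve N u 0). Qed.

Lemma jet_curveD N u v z :
  jet_curve N (fun j => u j + v j) z = jet_curve N u z + jet_curve N v z.
Proof.
apply/colP => i; rewrite !mxE -hornerD; congr horner; apply/polyP => j.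
rewrite coefD !coef_poly; case: ifP => _; last by rewrite addr0.
by rewrite mxE mulrDl.
Qed.

Lemma jet_curveB N u v z :
  jet_curve N (fun j => u j - v j) z = jet_curve N u z - jet_curve N v z.
Proof.
apply/colP => i; rewrite !mxE -hornerN -hornerD; congr horner; apply/polyP => j.
rewrite coefB !coef_poly; case: ifP => _; last by rewrite subr0.
by rewrite !mxE mulrBl.
Qed.

Lemma lead_jet_curve N (u : nat -> V) k i : (k <= N)%N ->
  (forall j, (j < k)%N -> u j = 0) ->
  lead z0 k (fun z => jet_curve N u z i 0) ((k`!%:R^-1 *: u k) i 0).
Proof.
move=> kN u0; rewrite jet_curve_entry; apply: lead_derive1n => [j jk|].
  by rewrite jet_poly_derive1n ?u0 ?mxE // (leq_trans (ltnW jk)).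
rewrite jet_poly_derive1n // mxE mulrA divff ?mul1r //.
by rewrite pnatr_eq0 -lt0n fact_gt0.
Qed.

Lemma derive1_jet_curve N u i : (0 < N)%N ->
  derive1 (fun z => jet_curve N u z i 0) z0 = u 1%N i 0.
Proof. by move=> N0; rewrite jet_curve_entry -derive1n1 jet_poly_derive1n. Qed.

End JetCurves.

(** * Iterated differentiation with respect to the new variable *)
Section ChangeOfVariable.
Variables (K : numFieldType) (O : set K) (oO : open O).
Implicit Types (X u v : K -> K).

(** Scalar counterpart of [dx], to which [dx] reduces entry by entry. *)
Definition dxs X j u : K -> K :=
  iter j (fun v z => (derive1 X z)^-1 * derive1 v z) u.

Definition parameter X := smooth O X /\ forall z, O z -> derive1 X z != 0.

Lemma smooth_rate X : parameter X -> smooth O (fun z => (derive1 X z)^-1).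
Proof. by move=> [sX X0]; apply: smoothV => //; exact: smooth_derive1. Qed.

Lemma smooth_dxs X j u : parameter X -> smooth O u -> smooth O (dxs X j u).
Proof.
move=> pX su; elim: j => // j IH /=; apply: smoothM => //.
  exact: smooth_rate.
exact: smooth_derive1.
Qed.

Lemma dx_entry m X j (Y : K -> 'cV[K]_m) i z : parameter X -> smooth O Y -> O z ->
  dx X j Y z i 0 = dxs X j (fun t => Y t i 0) z.
Proof.
move=> pX sY; have sdx k : smooth O (dx X k Y).
  elim: k => // k IH; apply/(smooth_mxP _ oO) => i' j'.
  have -> : (fun x => dx X k.+1 Y x i' j') =
      (fun x => (derive1 X x)^-1) \* (fun x => derive1 (dx X k Y) x i' j').
    by apply/funext => x; rewrite /= mxE.
  apply: smoothM => //; first exact: smooth_rate.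
  by apply: smooth_entry => //; exact: smooth_derive1.
elim: j z => // j IH z Oz; rewrite /= mxE (derive1_mxE _ _ (sdx j) Oz).
by congr (_ * _); apply: (derive1_ext oO Oz) => t Ot; exact: IH.
Qed.

Lemma dxs_ext X X' j u u' z : (forall t, O t -> X t = X' t) ->
  (forall t, O t -> u t = u' t) -> O z -> dxs X j u z = dxs X' j u' z.
Proof.
move=> XX uu; elim: j z => [|j IH] z Oz /=; first exact: uu.
by rewrite (derive1_ext oO Oz XX) (derive1_ext oO Oz IH).
Qed.

Lemma dxsB X j u v z : parameter X -> smooth O u -> smooth O v -> O z ->
  dxs X j (u \- v) z = dxs X j u z - dxs X j v z.
Proof.
move=> pX su sv; elim: j z => [|j IH] z Oz //=.
rewrite -mulrBr -(derive1_sub (smooth_dxs j pX su) (smooth_dxs j pX sv) Oz).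
by congr (_ * _); exact: (derive1_ext oO Oz).
Qed.

Variables (z0 : K) (Oz0 : O z0).

Lemma lead_dxs X k u c j : parameter X -> smooth O u -> (j <= k)%N ->
  lead z0 k u c ->
  lead z0 (k - j) (dxs X j u) ((k ^_ j)%:R * (derive1 X z0)^-1 ^+ j * c).
Proof.
move=> pX su + uc; elim: j => [|j IH] jk.
  by rewrite subn0 ffactn0 expr0 !mul1r.
have := IH (ltnW jk); rewrite subnS -(ltn_predK (_ : 0 < k - j)%N) ?subn_gt0 //=.
move=> [_]; set e := (k - j).-1; set c' := (_ * c) => H.
have eE : (k - j)%N = e.+1 by rewrite prednK // subn_gt0.
have H' := leadM oO Oz0 (smooth_rate pX) (smooth_derive1 (smooth_dxs j pX su))
  (erefl : lead z0 0 (fun z => (derive1 X z)^-1) _) H.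
rewrite add0n in H'; move: H'; congr (lead z0 _ _ _).
by rewrite /c' ffactnSr natrM eE exprS; ring.
Qed.

(** Because [1 / x - 1 / y = - (x - y) / (x * y)]. *)
Lemma lead_rate_sub X X' k c : parameter X -> parameter X' ->
  derive1 X' z0 = derive1 X z0 ->
  lead z0 k (derive1 X \- derive1 X') c ->
  lead z0 k ((fun z => (derive1 X z)^-1) \- (fun z => (derive1 X' z)^-1))
    (- c * (derive1 X z0)^-1 ^+ 2).
Proof.
move=> pX pX' XE lX; have [sX X0] := pX; have [sX' X'0] := pX'.
have sR := smooth_rate pX; have sR' := smooth_rate pX'.
have sXX := smoothB oO (smooth_derive1 sX) (smooth_derive1 sX').
have H := leadM oO Oz0 sXX (smoothM oO sR sR') lX (erefl _ : lead z0 0 _ _).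
have := leadZ oO Oz0 (-1) (smoothM oO sXX (smoothM oO sR sR')) H.
rewrite addn0 /= XE (_ : -1 * (c * _) = - c * (derive1 X z0)^-1 ^+ 2); last first.
  by rewrite mulN1r mulNr expr2.
apply: (lead_ext oO Oz0) => z Oz /=; have [x0 x'0] := (X0 _ Oz, X'0 _ Oz).
by rewrite mulN1r mulrBl mulVKf // mulrCA divff // mulr1 opprB.
Qed.

Lemma lead_quotient_sub X X' u u' k c d :
  parameter X -> parameter X' -> smooth O u -> smooth O u' ->
  lead z0 k ((fun z => (derive1 X z)^-1) \- (fun z => (derive1 X' z)^-1)) c ->
  lead z0 k (derive1 u \- derive1 u') d ->
  lead z0 k ((fun z => (derive1 X z)^-1 * derive1 u z) \-
             (fun z => (derive1 X' z)^-1 * derive1 u' z))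
    ((derive1 X z0)^-1 * d + c * derive1 u' z0).
Proof.
move=> pX pX' su su' lR lu.
have sR := smooth_rate pX; have sR' := smooth_rate pX'.
have sRR := smoothB oO sR sR'.
have suu := smoothB oO (smooth_derive1 su) (smooth_derive1 su').
have H1 := leadM oO Oz0 sR suu (erefl _ : lead z0 0 _ _) lu.
have H2 := leadM oO Oz0 sRR (smooth_derive1 su') lR (erefl _ : lead z0 0 _ _).
rewrite add0n in H1; rewrite addn0 in H2.
have := leadD oO Oz0 (smoothM oO sR suu) (smoothM oO sRR (smooth_derive1 su')) H1 H2.
by apply: (lead_ext oO Oz0) => z Oz /=; rewrite mulrBr mulrBl addrA subrK.
Qed.

(** Changing a jet at its top order [n] changes the derivative of order [n] of
    the new dependent variable linearly, the independent variable contributing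
    through the first derivative only. *)
Lemma dxs_sub_top X X' u u' n (xi eta : K) : (1 < n)%N ->
  parameter X -> parameter X' -> smooth O u -> smooth O u' ->
  lead z0 n (X \- X') xi -> lead z0 n (u \- u') eta ->
  dxs X n u z0 - dxs X' n u' z0 = n`!%:R * (derive1 X z0)^-1 ^+ n *
    (eta - xi * (derive1 X z0)^-1 * derive1 u z0).
Proof.
move=> n1 pX pX' su su' lX lu; have [sX X0] := pX; have [sX' X'0] := pX'.
case: n n1 lX lu => // n n1 [_ lX] [_ lu].
have {}lX : lead z0 n (derive1 X \- derive1 X') (n.+1%:R * xi).
  by apply: (lead_ext oO Oz0 _ lX) => z Oz; rewrite (derive1_sub sX sX' Oz).
have {}lu : lead z0 n (derive1 u \- derive1 u') (n.+1%:R * eta).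
  by apply: (lead_ext oO Oz0 _ lu) => z Oz; rewrite (derive1_sub su su' Oz).
have n0 : (0 < n)%N by [].
have XE : derive1 X' z0 = derive1 X z0.
  by have /= /subr0_eq := lead_lt n0 lX.
have uE : derive1 u' z0 = derive1 u z0.
  by have /= /subr0_eq := lead_lt n0 lu.
have lR := lead_rate_sub pX pX' XE lX.
have [r rE] : exists r, (derive1 X z0)^-1 = r by exists (derive1 X z0)^-1.
rewrite rE in lR *.
(* Only the first division by X' sees the variation of X: later on it is of
   higher order than the variation of the differentiated function. *)
have step j : (j <= n)%N ->
    lead z0 (n - j) (dxs X j.+1 u \- dxs X' j.+1 u')
      ((n.+1 ^_ j.+1)%:R * r ^+ j.+1 * (eta - xi * r * derive1 u z0)).
  elim: j => [|j IH] jn.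
    have := lead_quotient_sub pX pX' su su' lR lu.
    rewrite subn0 uE rE (_ : _ + _ * derive1 u z0 =
      (n.+1 ^_ 1)%:R * r ^+ 1 * (eta - xi * r * derive1 u z0)) //.
    by rewrite ffactn1; ring.
  have {IH} := IH (ltnW jn).
  have e1 : (n - j)%N = (n - j.+1).+1 by rewrite subnSK.
  rewrite e1 => -[_]; set c := (_ * (eta - _)) => H.
  have sd := smooth_dxs j.+1 pX su; have sd' := smooth_dxs j.+1 pX' su'.
  have {}H : lead z0 (n - j.+1) (derive1 (dxs X j.+1 u) \- derive1 (dxs X' j.+1 u'))
      ((n - j)%:R * c).
    rewrite e1; apply: (lead_ext oO Oz0 _ H) => z Oz.
    by rewrite (derive1_sub sd sd' Oz).
  have lt_n : (n - j.+1 < n)%N by rewrite ltn_subrL (leq_ltn_trans _ jn).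
  have := lead_quotient_sub pX pX' sd sd' (lead_lt lt_n lR) H.
  rewrite mul0r addr0 rE (_ : _ * (_ * c) =
    (n.+1 ^_ j.+2)%:R * r ^+ j.+2 * (eta - xi * r * derive1 u z0)) //.
  by rewrite /c (ffactnSr n.+1 j.+1) subSS natrM (exprS _ j.+1); ring.
have := step n (leqnn n); rewrite subnn ffactnn; exact.
Qed.

End ChangeOfVariable.

(** * Functions with vanishing derivatives *)
Section Constancy.
Variable K : numFieldType.

Lemma connected_locally_constant (E : topologicalType) (T : Type) (D : set E)
    (u : E -> T) :
  open D -> connected D ->
  (forall p, D p -> \forall q \near p, u q = u p) ->
  forall p q, D p -> D q -> u p = u q.
Proof.
move=> oD cD lc p q Dp Dq.
have near_D x : D x -> \forall y \near x, D y /\ u y = u x.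
  by move=> Dx; apply: filterI; [exact: open_nbhs_nbhs|exact: lc].
pose B := [set x | D x /\ u x = u p].
have oB : open B.
  rewrite openE => x [Dx ux]; apply: filterS (near_D _ Dx) => y [Dy uy].
  by split=> //; rewrite uy.
have oB' : open [set x | D x /\ u x <> u p].
  rewrite openE => x [Dx ux]; apply: filterS (near_D _ Dx) => y [Dy uy].
  by split=> //; rewrite uy.
suff /seteqP[_ /(_ q Dq)[_ ->]] : B = D by [].
apply: cD; first by exists p.
- exists B => //; apply/seteqP; split=> [x [Dx ux]|x [_ //]].
  by split.
- exists (~` [set x | D x /\ u x <> u p]); first exact: open_closedC.
  apply/seteqP; split=> [x [Dx ux]|x [Dx nux]]; first by split=> // -[].
  by split=> //; apply: contrapT => ux; exact: nux.
Qed.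

(** The positive integers already provide too many roots. *)
Lemma poly_eq0_nonzero (p : {poly K}) : (forall x, x != 0 -> p.[x] = 0) -> p = 0.
Proof.
move=> p0; apply/eqP; apply: contraT => pn0.
pose rs : seq K := [seq i.+1%:R | i <- iota 0 (size p)].
have rp : all (root p) rs.
  by apply/allP => x /mapP[i _ ->]; apply/rootP/p0; rewrite pnatr_eq0.
have urs : uniq rs.
  rewrite map_inj_uniq ?iota_uniq // => i j /eqP.
  by rewrite eqr_nat eqSS => /eqP.
by have := max_poly_roots pn0 rp urs; rewrite size_map size_iota ltnn.
Qed.

Hypothesis hK : constants_of_derivation K.

Lemma derive1_eq0_const (r : K) (g : K -> K) :
  (forall t, ball 0 r t -> derivable g t 1 /\ derive1 g t = 0) ->
  forall t, ball 0 r t -> g t = g 0.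
Proof.
move=> g0; apply: hK => t /g0[dg Dg].
by apply: DeriveDef => //; rewrite -derive1E.
Qed.

Lemma derive1_eq0_connected (D : set K) (g : K -> K) : domain D -> smooth D g ->
  (forall z, D z -> derive1 g z = 0) -> forall z t, D z -> D t -> g z = g t.
Proof.
move=> [oD cD _] sg g0; apply: connected_locally_constant => // z Dz.
have /nbhs_ballP[e /= e0 zD] := open_nbhs_nbhs (conj oD Dz).
apply/nbhs_ballP; exists e => // t; apply: (hK (a := z)) => s /zD Ds.
apply: DeriveDef; last by rewrite -derive1E g0.
exact/diff_derivable/(smooth_differentiable sg).
Qed.

Variable m : nat.
Local Notation V := 'cV[K]_m.
Variables (D : set K) (W : set V) (oD : open D) (oW : open W).
Implicit Types (g : K * V -> K) (z : K) (w v : V).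

Lemma open_setM : open (D `*` W).
Proof.
have -> : D `*` W = (fst @^-1` D) `&` (snd @^-1` W) by apply/seteqP; split.
by apply: openI; apply: open_comp => // p _; [exact: cvg_fst|exact: cvg_snd].
Qed.

(** Segments around a point of [W] are parametrized over a ball of radius two,
    so that the parameters zero and one are both interior. *)
Lemma near_segment w : W w -> exists2 e : K, 0 < e &
  forall v, `|v| < e -> forall s, ball (0 : K) 2 s -> W (w + s *: v).
Proof.
move=> Ww; have /nbhs_ballP[r /= r0 rW] := open_nbhs_nbhs (conj oW Ww).
exists (r / 2); first by rewrite divr_gt0.
move=> v ve s; rewrite -ball_normE /ball_ /= sub0r normrN => s2.
apply: rW; rewrite -ball_normE /ball_ /= opprD addNKr normrN normrZ.
have [->|v0] := eqVneq v 0; first by rewrite normr0 mulr0.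
apply: (@lt_trans _ _ (2 * `|v|)); first by rewrite ltr_pM2r ?normr_gt0.
by rewrite mulrC -ltr_pdivlMr.
Qed.

Let ball1 : ball (0 : K) 2 1.
Proof. by rewrite -ball_normE /ball_ /= sub0r normrN normr1 ltr1n. Qed.

Lemma is_derive_segment g z w v s : smooth (D `*` W) g -> D z -> W (w + s *: v) ->
  is_derive s 1 (fun t : K => g (z, w + t *: v)) ('D_(0, v) g (z, w + s *: v)).
Proof.
move=> sg Dz Ws; set p := (z, w + s *: v).
have Up : (D `*` W) p by [].
have dg : derivable g p (0, v) := diff_derivable (smooth_differentiable sg Up).
have E : (fun h : K => h^-1 *: ((g \o shift p) (h *: (0, v)) - g p)) =
  (fun h : K => h^-1 *: (((fun t : K => g (z, w + t *: v)) \o shift s) (h *: 1) -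
    g (z, w + s *: v))).
  apply/funext => h; congr (_ *: (g _ - _)); congr pair => /=.
    by rewrite scaler0 add0r.
  by rewrite [h%:A]mulr1 scalerDl addrCA.
by split; [rewrite /derivable -E|rewrite /derive -E].
Qed.

Lemma slice_const g z w : smooth (D `*` W) g -> D z -> W w ->
  (forall v w', W w' -> 'D_(0, v) g (z, w') = 0) ->
  \forall w' \near w, g (z, w') = g (z, w).
Proof.
move=> sg Dz Ww g0; have [e e0 eW] := near_segment Ww.
apply/nbhs_ballP; exists e => // w'; rewrite -ball_normE /ball_ /= distrC => w'e.
have H s : ball (0 : K) 2 s ->
    derivable (fun t : K => g (z, w + t *: (w' - w))) s 1 /\
    derive1 (fun t : K => g (z, w + t *: (w' - w))) s = 0.
  move=> s2; have Ws := eW _ w'e s s2.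
  have [dg Dg] := is_derive_segment sg Dz Ws.
  by rewrite derive1E Dg g0.
have := derive1_eq0_const H ball1.
by rewrite scale1r scale0r addr0 addrC subrK => ->.
Qed.

(** Taylor's formula along a segment: a function with zero second derivative has
    constant derivative, and subtracting the linear term leaves a constant. *)
Lemma slice_affine g z w : smooth (D `*` W) g -> D z -> W w ->
  (forall v w', W w' -> 'D_(0, v) ('D_(0, v) g) (z, w') = 0) ->
  exists2 e : K, 0 < e &
    forall v, `|v| < e -> W (w + v) /\ g (z, w + v) = g (z, w) + 'D_(0, v) g (z, w).
Proof.
move=> sg Dz Ww g0; have [e e0 eW] := near_segment Ww.
exists e => // v ve.
have sDg := smooth_derive ((0, v) : K * V) sg.
split; first by have := eW _ ve _ ball1; rewrite scale1r.
have D1 s : ball (0 : K) 2 s -> 'D_(0, v) g (z, w + s *: v) = 'D_(0, v) g (z, w).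
  move=> s2; have H t : ball (0 : K) 2 t ->
      derivable (fun t : K => 'D_(0, v) g (z, w + t *: v)) t 1 /\
      derive1 (fun t : K => 'D_(0, v) g (z, w + t *: v)) t = 0.
    move=> /(eW _ ve) Wt; have [dg Dg] := is_derive_segment sDg Dz Wt.
    by rewrite derive1E Dg g0.
  by rewrite (derive1_eq0_const H s2) scale0r addr0.
set c := 'D_(0, v) g (z, w) in D1 *.
have H t : ball (0 : K) 2 t -> derivable (fun t : K => g (z, w + t *: v) - t * c) t 1 /\
    derive1 (fun t : K => g (z, w + t *: v) - t * c) t = 0.
  move=> t2; have Wt := eW _ ve _ t2.
  have H1 := is_derive_segment sg Dz Wt.
  have H2 : is_derive t 1 (fun t : K => t * c) c.
    have di := @derivable_id K K t 1; have dc := @derivable_cst K K K c t 1.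
    split; first exact: derivableM di dc.
    by rewrite [LHS](deriveM di dc) derive_id derive_cst scaler0 add0r [_ *: 1]mulr1.
  have [dg Dg] := is_deriveB H1 H2.
  by split; [exact: dg|rewrite derive1E [LHS]Dg D1 // subrr].
have := derive1_eq0_const H ball1.
rewrite scale1r scale0r addr0 mul1r mul0r subr0 => <-.
by rewrite subrK.
Qed.

End Constancy.

(** * Consequences of equivalence on jets *)
Section Completion.
Variables (K : numFieldType) (m n : nat).
Local Notation V := 'cV[K]_m.
Implicit Types (B C : coefficients K m) (u : nat -> V).

(** The jet of a solution: the derivative of order [n] is computed from the
    lower ones by the equation. *)
Definition complete_jet C z u j : V :=
  if j == n then - \sum_(1 <= k < n.+1) C k z *m u (n - k)%N else u j.

Lemma jet_equation_ext B x u v : (forall j, (j <= n)%N -> u j = v j) ->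
  jet_equation n B x u <-> jet_equation n B x v.
Proof.
move=> uv; rewrite /jet_equation uv //.
by under eq_big_nat => k _ do rewrite uv ?leq_subr //.
Qed.

Lemma complete_jet_equation C z u : jet_equation n C z (complete_jet C z u).
Proof.
rewrite /jet_equation {1}/complete_jet eqxx addrC -sumrN -big_split /=.
rewrite big_nat big1 // => k /andP[k1 kn]; rewrite /complete_jet.
case: eqP => [E|_]; last by rewrite subrr.
by move: k1; rewrite -(subKn (_ : k <= n)%N) // E subnn.
Qed.

Lemma complete_jetD C z u v j :
  complete_jet C z (fun j => u j + v j) j = complete_jet C z u j + complete_jet C z v j.
Proof.
rewrite /complete_jet; case: eqP => // _.
by rewrite -opprD -big_split /=; congr (- _); apply: eq_bigr => k _; rewrite mulmxDr.
Qed.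

Lemma complete_jet_lt C z u j : (j < n)%N -> complete_jet C z u j = u j.
Proof. by move=> jn; rewrite /complete_jet ltn_eqF. Qed.

Definition scalar_system (b : K) : coefficients K m :=
  fun k _ => if k == n then b%:M else 0.

Lemma scalar_system_normal J b : (1 < n)%N -> normal_family n J (scalar_system b).
Proof.
move=> n1; split=> [k _|x _]; last by rewrite /scalar_system ltn_eqF.
exact: smooth_cst.
Qed.

Lemma scalar_system_jet b x u : (0 < n)%N ->
  jet_equation n (scalar_system b) x u <-> u n + b *: u 0%N = 0.
Proof.
move=> n0; rewrite /jet_equation big_nat_recr //= big_nat big1 => [|k /andP[_ kn]].
  by rewrite add0r /scalar_system eqxx subnn mul_scalar_mx.
by rewrite /scalar_system ltn_eqF ?mul0mx.
Qed.

(** The value and the velocity are the only data to be varied; the order [n] is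
    meant to be overwritten by [complete_jet]. *)
Definition first_jet (w0 w1 : V) (j : nat) : V :=
  if j == 0%N then w0 else if j == 1%N then w1 else 0.

Lemma complete_first_jet C z w0 w1 : (1 < n)%N ->
  complete_jet C z (first_jet w0 w1) n = - (C n z *m w0 + C n.-1 z *m w1).
Proof.
rewrite /complete_jet eqxx; case: n => [//|[//|l] _].
rewrite big_nat_recr //= big_nat_recr //= big_nat big1 => [|k /andP[k1 kl]].
  by rewrite subnn subSn // subnn add0r addrC.
have : (1 < l.+2 - k)%N by rewrite ltn_subRL addn1 ltnS.
by rewrite /first_jet; case: (l.+2 - k)%N => [|[|e]] //= _; rewrite mulmx0.
Qed.

End Completion.

Section Transformation.
Variables (K : numFieldType) (m n : nat) (n1 : (1 < n)%N).
Local Notation V := 'cV[K]_m.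
Variables (D : set K) (W : set V) (oD : open D) (oW : open W).
Variables (phi : point_transformation K m).
Let U := D `*` W.
Hypothesis sphi : smooth U phi.
Let oU : open U := open_setM oD oW.

Definition fx (p : K * V) : K := (phi p).1.
Definition ty (i : 'I_m) (p : K * V) : K := (phi p).2 i 0.

Lemma smooth_fx : smooth U fx.
Proof.
apply: (@smooth_linear_comp _ _ _ _ U fst phi oU) => // p; exact: cvg_fst.
Qed.

Lemma smooth_ty i : smooth U (ty i).
Proof.
apply: (@smooth_entry _ _ U _ _ (snd \o phi) i 0 oU).
by apply: (@smooth_linear_comp _ _ _ _ U snd phi oU) => // p; exact: cvg_snd.
Qed.

Lemma derive_phi p h : U p ->
  'D_h phi p = ('D_h fx p, \col_i 'D_h (ty i) p).
Proof.
move=> Up; have dphi := smooth_differentiable sphi Up.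
have c1 : continuous (fst : {linear (K * V)%type -> K}) by move=> q; exact: cvg_fst.
have c2 : continuous (snd : {linear (K * V)%type -> V}) by move=> q; exact: cvg_snd.
have d1 : differentiable (fst : K * V -> K) (phi p) by exact: linear_differentiable.
have d2 : differentiable (snd : K * V -> V) (phi p) by exact: linear_differentiable.
rewrite [LHS]surjective_pairing; congr pair.
  rewrite (deriveE h dphi) [RHS](deriveE h (differentiable_comp dphi d1)).
  by rewrite (diff_comp dphi d1) (diff_lin _ c1).
apply/colP => i; rewrite mxE.
rewrite -(@derive_mxE K _ _ _ (snd \o phi) p h i 0); last exact: differentiable_comp.
rewrite (deriveE h dphi) (deriveE h (differentiable_comp dphi d2)).
by rewrite (diff_comp dphi d2) (diff_lin _ c2).
Qed.

(** The differential of the inverse is a left inverse of that of [phi]. *)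
Lemma derive_phi_inj p h : open (phi @` U) -> U p ->
  (exists2 psi : point_transformation K m,
     smooth (phi @` U) psi & forall q, U q -> psi (phi q) = q) ->
  'D_h fx p = 0 -> (forall i, 'D_h (ty i) p = 0) -> h = 0.
Proof.
move=> ophi Up [psi spsi psiK] fx0 ty0.
have dphi := smooth_differentiable sphi Up.
have dpsi : differentiable psi (phi p).
  by apply: smooth_differentiable spsi _; exists p.
have : 'D_h (psi \o phi) p = 'D_h id p.
  apply: near_eq_derive; apply: filterS (open_nbhs_nbhs (conj oU Up)) => q Uq.
  exact: psiK.
have Dphi : 'd phi p h = 0.
  rewrite -(deriveE h dphi) (derive_phi h Up) fx0; congr pair.
  by apply/colP => i; rewrite !mxE ty0.
rewrite derive_id (deriveE h (differentiable_comp dphi dpsi)) (diff_comp dphi dpsi) /=.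
move=> <-; transitivity ('d psi (phi p) 0); last exact: linear0.
by congr ('d psi (phi p) _); exact: Dphi.
Qed.

Lemma derive_dirD (g : K * V -> K) p (a b : K * V) (s : K) : differentiable g p ->
  'D_(a + s *: b) g p = 'D_a g p + s * 'D_b g p.
Proof. by move=> dg; rewrite !deriveE // linearD linearZ. Qed.

(** A neighbourhood on which [w] stays in [W] and the new independent variable
    is a legitimate parameter. *)
Definition admissible (O : set K) (w : K -> V) :=
  [/\ open O, O `<=` D, curve_in U O w & parameter O (fx \o graph w)].

Lemma admissible_sub O O' w : open O' -> O' `<=` O -> admissible O w ->
  admissible O' w.
Proof.
move=> oO' O'O [oO OD [sw wU] [sX X0]]; split=> //.
- exact: subset_trans OD.
- by split; [exact: smooth_subset sw|move=> z /O'O /wU].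
- by split; [exact: smooth_subset sX|move=> z /O'O /X0].
Qed.

Lemma derive1_graph (g : K * V -> K) O w z : open O -> smooth U g ->
  curve_in U O w -> O z ->
  derive1 (g \o graph w) z = 'D_(1, 0) g (graph w z) +
    'D_(0, \col_i derive1 (fun t => w t i 0) z) g (graph w z).
Proof.
move=> oO sg [sw wU] Oz; rewrite (derive1_along oO sg sw wU Oz) derive_dir.
  by congr +%R; apply: eq_bigr => i _; rewrite mxE.
exact: smooth_differentiable sg (wU _ Oz).
Qed.

Variable z0 : K.
Hypothesis Dz0 : D z0.

Lemma jet_curve_tangent (u : nat -> V) :
  \col_i derive1 (fun t => jet_curve z0 n u t i 0) z0 = u 1%N.
Proof. by apply/colP => i; rewrite mxE derive1_jet_curve // ltnW. Qed.

Lemma admissible_jet_curve (u : nat -> V) : W (u 0%N) ->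
  'D_(1, 0) fx (z0, u 0%N) + 'D_(0, u 1%N) fx (z0, u 0%N) != 0 ->
  exists2 O, O z0 & admissible O (jet_curve z0 n u).
Proof.
move=> W0 X0; set w := jet_curve z0 n u.
have sw O : open O -> smooth O w by exact: smooth_jet_curve.
have cw : continuous w by move=> z; exact: smooth_continuous (sw _ openT) _.
pose O1 := D `&` w @^-1` W.
have oO1 : open O1 by apply: openI => //; apply: open_comp => // z _; exact: cw.
have wz0 : w z0 = u 0%N by exact: jet_curve0.
have O1z0 : O1 z0 by split=> //; rewrite /= wz0.
have cw1 : curve_in U O1 w by split; [exact: sw|move=> z []].
have sX := smooth_curve_in oO1 smooth_fx cw1.
have X'0 : derive1 (fx \o graph w) z0 != 0.
  by rewrite (derive1_graph oO1 smooth_fx cw1) // jet_curve_tangent /graph wz0.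
have near0 : \forall z \near z0, O1 z /\ derive1 (fx \o graph w) z != 0.
  apply: filterI; first exact: open_nbhs_nbhs.
  exact: (cvgr_neq0 _ (smooth_continuous (smooth_derive1 sX) O1z0) X'0).
exists [set z | O1 z /\ derive1 (fx \o graph w) z != 0]^°; first exact: near0.
have subO := @interior_subset _ [set z | O1 z /\ derive1 (fx \o graph w) z != 0].
split; first exact: open_interior.
- by move=> z /subO[[]].
- by split; [apply: sw; exact: open_interior|move=> z /subO[[]]].
- split; first by apply: smooth_subset sX => z /subO[].
  by move=> z /subO[].
Qed.

Lemma transforms_jet B C O w : transforms n D W phi B C -> admissible O w -> O z0 ->
  jet_equation n B (fx (graph w z0))
    (fun j => \col_i dxs (fx \o graph w) j (ty i \o graph w) z0) <->
  jet_equation n C z0 (fun j => derive1n j w z0).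
Proof.
move=> tr [oO OD [sw wU] [sX X0]] Oz0.
have {}tr := tr O w oO OD sw (fun z Oz => (wU z Oz).2) X0 z0 Oz0.
apply: iff_trans tr; apply: jet_equation_ext => j _; apply/colP => i; rewrite mxE.
rewrite (@dx_entry _ O oO _ (fx \o graph w) j) //.
have sg := smooth_graph oO sw.
apply/(smooth_mxP _ oO) => i' j'; rewrite (ord1 j').
exact: (smooth_along oO (smooth_ty i') sw wU).
Qed.

Definition solution (C : coefficients K m) (u : nat -> V) := jet_curve z0 n (complete_jet n C z0 u).

Lemma solution0 C u : solution C u z0 = u 0%N.
Proof. by rewrite /solution jet_curve0 complete_jet_lt // ltnW. Qed.

Lemma solution_admissible C (u : nat -> V) : W (u 0%N) ->
  'D_(1, 0) fx (z0, u 0%N) + 'D_(0, u 1%N) fx (z0, u 0%N) != 0 ->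
  exists2 O, O z0 & admissible O (solution C u).
Proof.
have n0 : (0 < n)%N := ltnW n1.
by move=> W0 X0; apply: admissible_jet_curve; rewrite !complete_jet_lt.
Qed.

Lemma solution_equation b C O u i :
  transforms n D W phi (scalar_system m n b) C ->
  admissible O (solution C u) -> O z0 ->
  dxs (fx \o graph (solution C u)) n (ty i \o graph (solution C u)) z0 =
    - b * ty i (z0, u 0%N).
Proof.
move=> tr aO Oz0.
have [_] := transforms_jet tr aO Oz0.
have n0 : (0 < n)%N := ltnW n1.
set J := jet_equation _ C _ _; have HJ : J.
  apply/(jet_equation_ext C z0 (v := complete_jet n C z0 u)) => [j jn|].
    exact: derive1n_jet_curve.
  exact: complete_jet_equation.
move=> /(_ HJ) /(scalar_system_jet _ _ _ n0) /colP/(_ i).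
by rewrite !mxE /= /graph solution0 mulNr => /eqP; rewrite addr_eq0 => /eqP.
Qed.

Lemma derive1_solution (g : K * V -> K) O C u : smooth U g -> admissible O (solution C u) -> O z0 ->
  derive1 (g \o graph (solution C u)) z0 =
  'D_(1, 0) g (z0, u 0%N) + 'D_(0, u 1%N) g (z0, u 0%N).
Proof.
move=> sg [oO _ cw _] Oz0; rewrite (derive1_graph oO sg cw Oz0).
by rewrite jet_curve_tangent complete_jet_lt // /graph solution0.
Qed.

(** Adding the identity matrix to the coefficient of the dependent variable
    shifts the derivative of order [n] of a solution by a vector [d], linear in
    the jet, whereas the new derivative of order [n] shifts by [ty].  Since the
    top derivative enters through the differential of [phi] only, the two
    shifts are related by the identity below.  Where [ty] is nonzero its sides
    have different degrees in the velocity [w1] unless [fx] is independent of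
    [w] to first order. *)
Lemma shift_identity C0 C1 (w0 w1 : V) i :
  transforms n D W phi (scalar_system m n 0) C0 ->
  transforms n D W phi (scalar_system m n 1) C1 -> W w0 ->
  let p := (z0, w0) in
  let alpha := 'D_(1, 0) fx p + 'D_(0, w1) fx p in
  let d := (C1 n z0 - C0 n z0) *m w0 + (C1 n.-1 z0 - C0 n.-1 z0) *m w1 in
  alpha != 0 ->
  ty i p * alpha ^+ n.+1 = 'D_(0, d) (ty i) p * alpha -
    'D_(0, d) fx p * ('D_(1, 0) (ty i) p + 'D_(0, w1) (ty i) p).
Proof.
move=> tr0 tr1 Ww0 p alpha d alpha0; pose u := first_jet w0 w1.
have [N0 N0z0 aN0] := solution_admissible (u := u) C0 Ww0 alpha0.
have [N1 N1z0 aN1] := solution_admissible (u := u) C1 Ww0 alpha0.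
pose O := N0 `&` N1; have Oz0 : O z0 by [].
have oO : open O by apply: openI; [case: aN0|case: aN1].
have a0 : admissible O (solution C0 u) by apply: admissible_sub aN0 => // z [].
have a1 : admissible O (solution C1 u) by apply: admissible_sub aN1 => // z [].
have E0 := solution_equation i tr0 a0 Oz0; have E1 := solution_equation i tr1 a1 Oz0.
have X'E := derive1_solution smooth_fx a0 Oz0.
have Y'E := derive1_solution (smooth_ty i) a0 Oz0.
have [_ _ cw0 pX0] := a0; have [_ _ cw1 pX1] := a1.
have n0 : (0 < n)%N := ltnW n1.
have wd j : lead z0 n ((fun z => solution C0 u z j 0) \- (fun z => solution C1 u z j 0))
    ((n`!%:R^-1 *: d) j 0).
  pose v k := complete_jet n C0 z0 u k - complete_jet n C1 z0 u k.
  have v0 k : (k < n)%N -> v k = 0 by move=> kn; rewrite /v !complete_jet_lt // subrr.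
  have dE : d = v n.
    rewrite /v !complete_first_jet // opprK addrC opprD addrACA.
    by rewrite -!mulmxBl.
  rewrite dE; apply: (lead_ext oO Oz0 _ (lead_jet_curve z0 j (leqnn n) v0)) => z _.
  by rewrite /v jet_curveB mxE [X in _ + X]mxE.
have lead_sub (g : K * V -> K) : smooth U g -> lead z0 n ((g \o graph (solution C0 u)) \-
    (g \o graph (solution C1 u))) ('D_(0, n`!%:R^-1 *: d) g p).
  move=> sg; have -> : p = graph (solution C1 u) z0 by rewrite /graph solution0.
  case: n n0 wd => // l _ wd.
  exact: (lead_along_sub oO Oz0 sg cw0 cw1 wd).
have := dxs_sub_top oO Oz0 n1 pX0 pX1 (smooth_curve_in oO (smooth_ty i) cw0)
  (smooth_curve_in oO (smooth_ty i) cw1) (lead_sub _ smooth_fx) (lead_sub _ (smooth_ty i)).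
rewrite E0 E1 X'E Y'E -/p -/alpha.
have Up : U p by [].
have DZ (g : K * V -> K) : smooth U g -> 'D_(0, n`!%:R^-1 *: d) g p = n`!%:R^-1 * 'D_(0, d) g p.
  move=> sg; have dg := smooth_differentiable sg Up.
  have := derive_dirD 0 ((0, d) : K * V) n`!%:R^-1 dg.
  rewrite add0r derive0 add0r => <-.
  by congr ('D_ _ g p); congr pair; rewrite /= scaler0.
rewrite !DZ; [|exact: smooth_fx|exact: smooth_ty].
have f0 : n`!%:R != 0 :> K by rewrite pnatr_eq0 -lt0n fact_gt0.
rewrite oppr0 mul0r sub0r mulNr opprK mul1r => ->.
rewrite exprVn exprS; move: (_ `!%:R) f0 => q q0; field.
by rewrite alpha0 q0 expf_neq0.
Qed.

(** Along the velocities [s v] the two sides of [shift_identity] are polynomials in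
    [s], of degree [n + 1] and at most two if the derivative does not vanish. *)
Lemma fx_vertical_derive0 C0 C1 (w0 v : V) i :
  transforms n D W phi (scalar_system m n 0) C0 ->
  transforms n D W phi (scalar_system m n 1) C1 -> W w0 ->
  ty i (z0, w0) != 0 -> 'D_(0, v) fx (z0, w0) = 0.
Proof.
move=> tr0 tr1 Ww0 t0; apply/eqP; apply: contraT => b0.
set p := (z0, w0) in t0 b0 *; have Up : U p by [].
set b := 'D_(0, v) fx p in b0; pose a : K := 'D_(1, 0) fx p.
pose e0 := (C1 n z0 - C0 n z0) *m w0.
pose e1 := (C1 n.-1 z0 - C0 n.-1 z0) *m v.
have lin (g : K * V -> K) (x y : V) s : smooth U g ->
    'D_(0, x + s *: y) g p = 'D_(0, x) g p + s * 'D_(0, y) g p.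
  move=> sg; rewrite -derive_dirD; last exact: smooth_differentiable sg Up.
  by congr ('D_ _ g p); congr pair; rewrite /= scaler0 addr0.
have linZ (g : K * V -> K) s : smooth U g ->
    'D_(0, s *: v) g p = s * 'D_(0, v) g p.
  by move=> sg; have := lin g 0 v s sg; rewrite add0r derive0 add0r.
pose a0 : K := 'D_(0, e0) (ty i) p; pose a1 : K := 'D_(0, e1) (ty i) p.
pose b1 : K := 'D_(0, e0) fx p; pose b2 : K := 'D_(0, e1) fx p.
pose c0 : K := 'D_(1, 0) (ty i) p; pose c1 : K := 'D_(0, v) (ty i) p.
(* The velocity is s v with s = (x - a) / b, so that x is the first derivative
   of the new independent variable. *)
have [S SE sS] : exists2 S : {poly K}, forall x, S.[x] = (x - a) / b &
    (size S <= 2)%N.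
  exists (b^-1 *: ('X - a%:P)) => [x|]; first by rewrite !hornerE mulrC.
  by rewrite (leq_trans (size_scale_leq _ _)) // size_XsubC.
pose P : {poly K} := (ty i p) *: 'X^(n.+1) -
  ((a0%:P + a1 *: S) * 'X - (b1%:P + b2 *: S) * (c0%:P + c1 *: S)).
have P0 : P = 0.
  apply: poly_eq0_nonzero => x x0; pose s := (x - a) / b.
  have Sx : S.[x] = s := SE x.
  have ax : a + 'D_(0, s *: v) fx p = x.
    by rewrite (linZ _ s smooth_fx) -/b /s divfK // addrC subrK.
  have := @shift_identity C0 C1 w0 (s *: v) i tr0 tr1 Ww0.
  rewrite /= -/p -/a ax => /(_ x0); rewrite -scalemxAr -/e0 -/e1.
  rewrite (lin _ e0 e1 s (smooth_ty i)) (lin _ e0 e1 s smooth_fx).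
  rewrite (linZ _ s (smooth_ty i)).
  rewrite -/a0 -/a1 -/b1 -/b2 -/c0 -/c1 => E.
  rewrite /P !(hornerD, hornerN, hornerM, hornerZ, hornerXn, hornerX, hornerC) Sx E.
  by ring.
have sL (x y : K) : (size (x%:P + y *: S)%R <= 2)%N.
  apply: leq_trans (size_polyD _ _) _; rewrite geq_max.
  rewrite (leq_trans (size_polyC_leq1 _)) //=.
  exact: leq_trans (size_scale_leq _ _) sS.
have sM (q1 q2 : {poly K}) : (size q1 <= 2)%N -> (size q2 <= 2)%N ->
    (size (q1 * q2)%R <= 3)%N.
  move=> s1 s2; apply: leq_trans (size_polyMleq _ _) _.
  by rewrite -subn1 (leq_trans (leq_sub2r 1 (leq_add s1 s2))).
have := congr1 (fun q : {poly K} => q`_n.+1) P0.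
rewrite coef0 coefB coefZ coefXn eqxx mulr1 [X in _ - X]nth_default ?subr0.
  by move=> t0'; rewrite t0' eqxx in t0.
apply: leq_trans (size_polyD _ _) _; rewrite size_polyN geq_max.
have n3 : (3 <= n.+1)%N by rewrite ltnS.
by apply/andP; split; apply: leq_trans n3; apply: sM => //; rewrite size_polyX.
Qed.

(** For the trivial equation, the second difference of four solutions is the
    second difference of [ty] along them; a velocity and a derivative of order
    [n - 1] in the same direction isolate the second derivative of [ty]. *)
Lemma ty_second_derive0 C0 (w0 v : V) i :
  transforms n D W phi (scalar_system m n 0) C0 ->
  (forall z w v, D z -> W w -> 'D_(0, v) fx (z, w) = 0) ->
  (forall z w w', D z -> W w -> W w' -> fx (z, w) = fx (z, w')) ->
  W w0 -> 'D_(1, 0) fx (z0, w0) != 0 ->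
  'D_(0, v) ('D_(0, v) (ty i)) (z0, w0) = 0.
Proof.
move=> tr0 fv0 fc Ww0 f'0.
pose up := first_jet w0 0.
pose uA j : V := if j == 1%N then v else 0.
(* The factorial gives both perturbations the leading Taylor coefficient v. *)
pose uB j : V := if j == n.-1 then (n.-1)`!%:R *: v else 0.
have n0 : (0 < n)%N := ltnW n1.
have uB0 : uB 0%N = 0 by rewrite /uB; case: n n1 => [|[]].
have good (u : nat -> V) : u 0%N = w0 -> exists2 O, O z0 & admissible O (solution C0 u).
  by move=> u0; apply: solution_admissible; rewrite u0 // fv0 // addr0.
have up0 : up 0%N = w0 by [].
have uA0 : uA 0%N = 0 by [].
pose uAp j := up j + uA j; pose uBp j := up j + uB j.
pose uABp j := up j + uA j + uB j.
have solD (u u' : nat -> V) z :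
    solution C0 (fun j => u j + u' j) z = solution C0 u z + solution C0 u' z.
  rewrite /solution -jet_curveD; congr (jet_curve z0 n _ z); apply/funext => j.
  exact: complete_jetD.
have [Op Opz ap] := good up up0.
have [OA OAz aA] : exists2 O, O z0 & admissible O (solution C0 uAp).
  by apply: good; rewrite /uAp uA0 addr0.
have [OB OBz aB] : exists2 O, O z0 & admissible O (solution C0 uBp).
  by apply: good; rewrite /uBp uB0 addr0.
have [OAB OABz aAB] : exists2 O, O z0 & admissible O (solution C0 uABp).
  by apply: good; rewrite /uABp uA0 uB0 !addr0.
pose O := (Op `&` OA) `&` (OB `&` OAB).
have oO : open O by do !apply: openI; [case: ap|case: aA|case: aB|case: aAB].
have Oz0 : O z0 by [].
have {}ap : admissible O (solution C0 up) by apply: admissible_sub ap => // z [[]].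
have {}aA : admissible O (solution C0 uAp) by apply: admissible_sub aA => // z [[]].
have {}aB : admissible O (solution C0 uBp) by apply: admissible_sub aB => // z [_ []].
have {}aAB : admissible O (solution C0 uABp) by apply: admissible_sub aAB => // z [_ []].
pose p := solution C0 up; pose A := solution C0 uA; pose B := solution C0 uB.
have EA : solution C0 uAp = p \+ A by apply/funext => z; exact: solD.
have EB : solution C0 uBp = p \+ B by apply/funext => z; exact: solD.
have EAB : solution C0 uABp = p \+ A \+ B.
  by apply/funext => z; rewrite (solD (fun j => up j + uA j) uB) solD.
have ssol (u : nat -> V) : smooth O (solution C0 u) by exact: smooth_jet_curve.
have [_ _ cp Xp] := ap; have [_ _ cA XA] := aA.
have [_ _ cB XB] := aB; have [_ _ cAB XAB] := aAB.
have EX (w w' : K -> V) t : curve_in U O w -> curve_in U O w' -> O t ->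
    (fx \o graph w) t = (fx \o graph w') t.
  by move=> [_ wU] [_ w'U] Ot; have [? ?] := wU _ Ot; have [_ ?] := w'U _ Ot; exact: fc.
have zero u : admissible O (solution C0 u) ->
    dxs (fx \o graph p) n (ty i \o graph (solution C0 u)) z0 = 0.
  move=> au; have := solution_equation i tr0 au Oz0; rewrite oppr0 mul0r => <-.
  by have [_ _ cu _] := au; apply: (dxs_ext oO n _ _ Oz0) => // t Ot; exact: EX.
have lA j : lead z0 1 (fun z => A z j 0) (v j 0).
  have := @lead_jet_curve _ _ z0 n (complete_jet n C0 z0 uA) 1 j n0.
  rewrite complete_jet_lt // /uA /= invr1 scale1r; apply => k.
  by rewrite ltnS leqn0 => /eqP->; rewrite complete_jet_lt.
have nE : n = (0.+1 + n.-2.+1)%N by case: n n1 => [|[]].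
have lB j : lead z0 n.-2.+1 (fun z => B z j 0) (v j 0).
  have n21 : n.-2.+1 = n.-1 by case: n n1 => [|[]].
  have n1n : (n.-1 < n)%N by rewrite ltn_predL.
  have := @lead_jet_curve _ _ z0 n (complete_jet n C0 z0 uB) n.-1 j (ltnW n1n).
  rewrite n21 complete_jet_lt // /uB eqxx scalerA mulVf; last first.
    by rewrite pnatr_eq0 -lt0n fact_gt0.
  rewrite scale1r; apply => k kn.
  by rewrite complete_jet_lt ?(ltn_trans kn) // ltn_eqF.
have sA := ssol uA; have sB := ssol uB; have sp := ssol up.
have H := lead_second_difference oO Oz0 sp sA sB cp.
rewrite EA in cA; rewrite EB in cB; rewrite EAB in cAB.
have {}H := H _ _ _ cA cB cAB lA lB _ oU (smooth_ty i).
rewrite -nE /graph /p solution0 up0 -/p in H.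
have sty w : curve_in U O w -> smooth O (ty i \o graph w).
  by move=> cw; exact: smooth_curve_in (smooth_ty i) cw.
have sBA := smoothB oO (sty _ cAB) (sty _ cA).
have sBp := smoothB oO (sty _ cB) (sty _ cp).
have := lead_dxs oO Oz0 Xp (smoothB oO sBA sBp) (leqnn n) H.
rewrite subnn /= (dxsB oO n Xp sBA sBp Oz0).
rewrite (dxsB oO n Xp (sty _ cAB) (sty _ cA) Oz0) (dxsB oO n Xp (sty _ cB) (sty _ cp) Oz0).
have := zero _ aAB; rewrite EAB => ->; have := zero _ aA; rewrite EA => ->.
have := zero _ aB; rewrite EB => ->; rewrite (zero _ ap) !subrr.
move=> /esym/eqP; rewrite ffactnn !mulf_eq0 pnatr_eq0 -leqn0 leqNgt fact_gt0 /=.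
rewrite expf_eq0 invr_eq0 (negbTE (Xp.2 _ Oz0)) andbF /= => /eqP.
exact.
Qed.

End Transformation.

(** * The transformation is linear in the dependent variable *)
Section Linearity.
Variables (K : numFieldType) (hK : constants_of_derivation K).
Variables (m n : nat) (n1 : (1 < n)%N) (m0 : (0 < m)%N).
Local Notation V := 'cV[K]_m.
Variables (D : set K) (W : set V) (hD : domain D) (hW : domain W).
Variables (phi : point_transformation K m).
Let U := D `*` W.
Hypothesis hphi : invertible_on U phi.

Let oD : open D. Proof. by case: hD. Qed.
Let oW : open W. Proof. by case: hW. Qed.
Let oU : open U := open_setM oD oW.
Let sphi : smooth U phi. Proof. by case: hphi. Qed.
Let sfx := smooth_fx oD oW sphi.
Let sty i := smooth_ty oD oW sphi i.

Let dphi_inj p h : U p -> 'D_h (fx phi) p = 0 ->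
  (forall i, 'D_h (ty phi i) p = 0) -> h = 0.
Proof. by case: hphi => _ ophi psi Up; exact: derive_phi_inj ophi Up psi. Qed.

Variables (C0 C1 : coefficients K m).
Hypothesis tr0 : transforms n D W phi (scalar_system m n 0) C0.
Hypothesis tr1 : transforms n D W phi (scalar_system m n 1) C1.

Let derive_comb (g : K * V -> K) p (a b : K * V) (s t : K) : differentiable g p ->
  'D_(s *: a + t *: b) g p = s * 'D_a g p + t * 'D_b g p.
Proof. by move=> dg; rewrite !deriveE // linearD !linearZ. Qed.

(** If [ty] vanished on an open set, the differential of [phi] would have rank at
    most one there and could not be injective.  So points where [ty] is nonzero
    are dense, and continuity settles the others. *)
Lemma fx_vertical z w v : D z -> W w -> 'D_(0, v) (fx phi) (z, w) = 0.
Proof.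
move=> Dz Ww; apply/eqP; apply: contraT => b0; pose p := (z, w).
have Up : U p by [].
have dfx := smooth_differentiable sfx Up.
have near_b : \forall q \near p, U q /\ 'D_(0, v) (fx phi) q != 0.
  apply: filterI; first exact: open_nbhs_nbhs.
  exact: (cvgr_neq0 _ (smooth_continuous (smooth_derive ((0, v) : K * V) sfx) Up) b0).
have ty0 i : \forall q \near p, ty phi i q = cst 0 q.
  apply: filterS near_b => -[z' w'] [[Dz' Ww'] b']; apply/eqP.
  apply: contraT => t0; have := fx_vertical_derive0 n1 oD oW sphi Dz' v tr0 tr1 Ww' t0.
  by move=> E; rewrite E eqxx in b'.
pose a : K := 'D_(1, 0) (fx phi) p; pose b : K := 'D_(0, v) (fx phi) p.
have h0 : b *: ((1, 0) : K * V) + (- a) *: (0, v) = 0.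
  apply: (dphi_inj Up) => [|i].
    by rewrite derive_comb // -/a -/b mulNr mulrC subrr.
  by rewrite (near_eq_derive _ (ty0 i)) derive_cst.
have := congr1 fst h0; rewrite /= scaler0 addr0 [_ *: 1]mulr1 => b0'.
by move: b0; rewrite -/p -/b b0' eqxx.
Qed.

Lemma fx_const z w w' : D z -> W w -> W w' -> fx phi (z, w) = fx phi (z, w').
Proof.
move=> Dz; case: hW => _ cW _.
apply: (connected_locally_constant (u := fun w => fx phi (z, w)) oW cW) => q Wq.
apply: (slice_const hK oW sfx Dz Wq) => v q' Wq'.
exact: fx_vertical.
Qed.

Definition ty_jacobian p : 'M[K]_m := \matrix_(i, j) 'D_(0, delta_mx j 0) (ty phi i) p.

Lemma ty_jacobianE p v i : U p -> 'D_(0, v) (ty phi i) p = (ty_jacobian p *m v) i 0.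
Proof.
move=> Up; rewrite derive_dir; last exact: smooth_differentiable (sty i) Up.
by rewrite mxE; apply: eq_bigr => j _; rewrite mxE.
Qed.

Lemma unitmx_kernel0 (M : 'M[K]_m) : (forall v : V, M *m v = 0 -> v = 0) -> M \in unitmx.
Proof.
move=> M0; rewrite -unitmx_tr -row_free_unit -kermx_eq0; apply/eqP/row_matrixP => i.
have : row i (kermx M^T) *m M^T = 0 by rewrite -row_mul mulmx_ker row0.
move=> /(congr1 trmx); rewrite trmx_mul trmxK trmx0 => /M0 E.
by rewrite row0; apply: trmx_inj; rewrite trmx0.
Qed.

Lemma ty_jacobian_unit p : U p -> ty_jacobian p \in unitmx.
Proof.
case: p => z w [Dz Ww]; apply: unitmx_kernel0 => v Mv.
have ty0 i : 'D_(0, v) (ty phi i) (z, w) = 0 by rewrite ty_jacobianE // Mv mxE.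
by have /(congr1 snd) := dphi_inj (conj Dz Ww : U (z, w)) (fx_vertical v Dz Ww) ty0.
Qed.

(** Evaluation along a constant curve. *)
Lemma fx_derive1 z w : D z -> W w ->
  derive1 (fun t => fx phi (t, w)) z = 'D_(1, 0) (fx phi) (z, w).
Proof.
move=> Dz Ww; have cw : curve_in U D (cst w).
  by split; [exact: smooth_cst|move=> t Dt; split].
have := derive1_graph oD sfx cw Dz.
have -> : \col_i derive1 (fun t => cst w t i 0) z = 0.
  by apply/colP => i; rewrite !mxE derive1_cst.
by rewrite derive0 addr0.
Qed.

(** Otherwise the differential of [phi] would map a space of dimension [m + 1]
    injectively into one of dimension [m]. *)
Lemma fx_horizontal z w : D z -> W w -> 'D_(1, 0) (fx phi) (z, w) != 0.
Proof.
move=> Dz Ww; apply/eqP => f0; pose p := (z, w); have Up : U p by [].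
pose t : V := \col_i 'D_(1, 0) (ty phi i) p.
pose v := - (invmx (ty_jacobian p) *m t).
have h0 : (1, v) = 0 :> K * V.
  have hE : (1, v) = 1 *: ((1, 0) : K * V) + 1 *: ((0, v) : K * V).
    by congr pair; rewrite /= !scale1r ?addr0 ?add0r.
  apply: (dphi_inj Up) => [|i]; rewrite hE derive_comb //.
  - by rewrite f0 fx_vertical // !mulr0 addr0.
  - exact: smooth_differentiable sfx Up.
  - rewrite (ty_jacobianE _ _ Up) !mul1r /v mulmxN mulmxA mulmxV ?ty_jacobian_unit //.
    by rewrite mul1mx /t !mxE subrr.
  - exact: smooth_differentiable (sty i) Up.
by have /eqP := congr1 fst h0; rewrite /= oner_eq0.
Qed.

Lemma ty_slice_affine z w : D z -> W w -> exists2 e : K, 0 < e &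
  forall v, `|v| < e -> W (w + v) /\
    forall i, ty phi i (z, w + v) = ty phi i (z, w) + (ty_jacobian (z, w) *m v) i 0.
Proof.
move=> Dz Ww.
have H i : exists2 e : K, 0 < e & forall v, `|v| < e -> W (w + v) /\
    ty phi i (z, w + v) = ty phi i (z, w) + (ty_jacobian (z, w) *m v) i 0.
  have D2 v w' : W w' -> 'D_(0, v) ('D_(0, v) (ty phi i)) (z, w') = 0.
    move=> Ww'; apply: (ty_second_derive0 n1 oD oW sphi Dz v i tr0) => //.
    - by move=> *; exact: fx_vertical.
    - by move=> *; exact: fx_const.
    - exact: fx_horizontal.
  have [e e0 eP] := slice_affine hK oW (sty i) Dz Ww D2.
  exists e => // v /eP[Wv E]; split=> //.
  by rewrite -ty_jacobianE.
have : \forall v \near (0 : V), W (w + v) /\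
    forall i, ty phi i (z, w + v) = ty phi i (z, w) + (ty_jacobian (z, w) *m v) i 0.
  pose P i v := W (w + v) /\
    ty phi i (z, w + v) = ty phi i (z, w) + (ty_jacobian (z, w) *m v) i 0.
  have : \forall v \near (0 : V), forall i, P i v.
    apply: (@filter_forall _ _ P _ (nbhs_filter (0 : V))) => i; have [e e0 eP] := H i.
    apply/nbhs_ballP; exists e => // v; rewrite -ball_normE /ball_ /= sub0r normrN.
    exact: eP.
  apply: filterS => v Hv; split; first by case: (Hv (Ordinal m0)).
  by move=> i; case: (Hv i).
move=> /nbhs_ballP[e /= e0 eP]; exists e => // v ve; apply: eP.
by rewrite -ball_normE /ball_ /= sub0r normrN.
Qed.

Lemma mx_eq_near (A B : 'M[K]_m) :
  (\forall u \near (0 : V), A *m u = B *m u) -> A = B.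
Proof.
move=> /nbhs_ballP[r /= r0 AB]; apply/matrixP => i j.
pose e : V := delta_mx j 0; pose t := r / (`|e| + 1).
have e1 : 0 < `|e| + 1 by rewrite ltr_wpDl.
have t0 : 0 < t by rewrite divr_gt0.
have /AB : ball (0 : V) r (t *: e).
  rewrite -ball_normE /ball_ /= sub0r normrN normrZ gtr0_norm // /t mulrAC.
  by rewrite ltr_pdivrMr // ltr_pM2l // ltrDl.
rewrite -!scalemxAr => /(scalerI (lt0r_neq0 t0)) /colP/(_ i).
by rewrite -!colE !mxE.
Qed.

(** Two nearby points see the same small displacements through their respective
    affine formulas. *)
Lemma ty_jacobian_const z w w' : D z -> W w -> W w' ->
  ty_jacobian (z, w) = ty_jacobian (z, w').
Proof.
move=> Dz; case: hW => _ cW _.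
apply: (connected_locally_constant (u := fun w => ty_jacobian (z, w)) oW cW) => q Wq.
have [e e0 eP] := ty_slice_affine Dz Wq.
apply/nbhs_ballP; exists e => // q'; rewrite -ball_normE /ball_ /= distrC => q'e.
pose v := q' - q; have qE : q' = q + v by rewrite /v addrC subrK.
have [Wq' tyq'] := eP _ q'e; rewrite -/v -qE in Wq' tyq'.
have [e' e'0 eP'] := ty_slice_affine Dz Wq'.
apply: mx_eq_near; near=> u.
have ue' : `|u| < e'.
  near: u; apply/nbhs_ballP; exists e' => // u.
  by rewrite -ball_normE /ball_ /= sub0r normrN.
have vue : `|v + u| < e.
  near: u; apply/nbhs_ballP; exists (e - `|v|); first by rewrite /= subr_gt0.
  move=> u; rewrite -ball_normE /ball_ /= sub0r normrN ltrBrDl.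
  exact/le_lt_trans/ler_normD.
apply/colP => i; have [_ /(_ i)] := eP' _ ue'; rewrite {1}qE -addrA.
have [_ /(_ i) ->] := eP _ vue; rewrite tyq' mulmxDr mxE addrA => /addrI ->.
by [].
Unshelve. all: by end_near. Qed.

(** The local affine formulas all have the same linear part, so the remaining
    term is locally constant. *)
Lemma ty_affine z w w' i : D z -> W w -> W w' ->
  ty phi i (z, w') - (ty_jacobian (z, w) *m w') i 0 =
  ty phi i (z, w) - (ty_jacobian (z, w) *m w) i 0.
Proof.
move=> Dz Ww Ww'; case: hW => _ cW _.
apply: (connected_locally_constant
  (u := fun w' => ty phi i (z, w') - (ty_jacobian (z, w) *m w') i 0) oW cW) => // q Wq.
have [e e0 eP] := ty_slice_affine Dz Wq.
apply/nbhs_ballP; exists e => // q'; rewrite -ball_normE /ball_ /= distrC => q'e.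
have [_ /(_ i)] := eP _ q'e; rewrite addrC subrK => ->.
by rewrite (ty_jacobian_const Dz Ww Wq) mulmxBr !mxE; ring.
Qed.

(** Comparing the two equations on constant jets gives [ty] as a linear function
    of [w], which an affine function with nonzero constant term is not. *)
Lemma ty_linear z w i : D z -> W w -> ty phi i (z, w) = (ty_jacobian (z, w) *m w) i 0.
Proof.
move=> Dz Ww; have Up : U (z, w) by [].
pose J := ty_jacobian (z, w); pose a : K := 'D_(1, 0) (fx phi) (z, w).
pose Q := C1 n z - C0 n z.
have a0 : a != 0 by exact: fx_horizontal.
have EQ w' j : W w' -> ty phi j (z, w') * a ^+ n = (J *m (Q *m w')) j 0.
  move=> Ww'; have Up' : U (z, w') by [].
  have aE : 'D_(1, 0) (fx phi) (z, w') = a.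
    rewrite -fx_derive1 // /a -fx_derive1 //.
    by apply: (derive1_ext oD Dz) => t Dt; exact: fx_const.
  have := shift_identity n1 oD oW sphi Dz (w1 := 0) j tr0 tr1 Ww'.
  rewrite /= aE !fx_vertical // addr0 mul0r subr0 mulmx0 addr0 => /(_ a0).
  rewrite exprSr mulrA => /(mulIf a0) ->.
  by rewrite ty_jacobianE // (ty_jacobian_const Dz Ww' Ww).
(* J (Q - a ^ n) takes the same value at all points of W. *)
pose M := J *m (Q - (a ^+ n)%:M).
pose t0 j : K := ty phi j (z, w) - (J *m w) j 0.
have ME w' j : W w' -> (M *m w') j 0 = a ^+ n * t0 j.
  move=> Ww'; rewrite /M -mulmxA mulmxBl mulmxBr mxE -EQ // mul_scalar_mx.
  rewrite -scalemxAr !mxE /t0 -(ty_affine j Dz Ww Ww') !mxE; ring.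
have M0 : M = 0.
  apply: mx_eq_near; have /nbhs_ballP[e /= e0 eW] := open_nbhs_nbhs (conj oW Ww).
  apply/nbhs_ballP; exists e => // u; rewrite -ball_normE /ball_ /= sub0r normrN => ue.
  have Wu : W (w + u).
    by apply: eW; rewrite -ball_normE /ball_ /= opprD addNKr normrN.
  have E : M *m (w + u) = M *m w by apply/colP => j; rewrite !ME.
  by rewrite mul0mx; move: E; rewrite mulmxDr -[RHS]addr0 => /addrI.
have := ME w i Ww; rewrite M0 mul0mx mxE => /esym/eqP.
by rewrite mulf_eq0 expf_eq0 (negbTE a0) andbF /= subr_eq0 => /eqP.
Qed.

End Linearity.

(** * Linear transformations of linear systems *)
Section MatrixProducts.
Variables (K : numFieldType) (O : set K) (oO : open O).

Lemma smooth_mulmx p q r (M : K -> 'M[K]_(p, q)) (N : K -> 'M[K]_(q, r)) :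
  smooth O M -> smooth O N -> smooth O (fun z => M z *m N z).
Proof.
move=> sM sN; apply/(smooth_mxP _ oO) => i j.
have H k : smooth O ((fun z => M z i k) \* (fun z => N z k j)).
  by apply: smoothM => //; exact: smooth_entry.
by apply: (smooth_ext oO _ (smooth_sum (index_enum _) oO H)) => z _; rewrite mxE.
Qed.

Lemma derive1_mulmx p q r (M : K -> 'M[K]_(p, q)) (N : K -> 'M[K]_(q, r)) z :
  smooth O M -> smooth O N -> O z ->
  derive1 (fun t => M t *m N t) z = derive1 M z *m N z + M z *m derive1 N z.
Proof.
move=> sM sN Oz; apply/matrixP => i j; rewrite (derive1_mxE _ _ (smooth_mulmx sM sN) Oz).
have sMN k : smooth O ((fun t => M t i k) \* (fun t => N t k j)).
  by apply: smoothM => //; exact: smooth_entry.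
have -> : (fun t => (M t *m N t) i j) =
    fun t => \sum_k ((fun t => M t i k) \* (fun t => N t k j)) t.
  by apply/funext => t; rewrite mxE.
rewrite (derive1_sum oO _ sMN Oz) !mxE -big_split /=; apply: eq_bigr => k _.
rewrite (@derive1_mul _ O) //; try exact: smooth_entry.
by rewrite (derive1_mxE _ _ sM Oz) (derive1_mxE _ _ sN Oz).
Qed.

Lemma smooth_scalemx p q (a : K -> K) (M : K -> 'M[K]_(p, q)) :
  smooth O a -> smooth O M -> smooth O (fun z => a z *: M z).
Proof.
move=> sa sM; apply/(smooth_mxP _ oO) => i j.
apply: (smooth_ext oO _ (smoothM oO sa (smooth_entry i j oO sM))) => z _.
by rewrite mxE.
Qed.

Lemma derive1_scalemx p q (a : K -> K) (M : K -> 'M[K]_(p, q)) z :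
  smooth O a -> smooth O M -> O z ->
  derive1 (fun t => a t *: M t) z = derive1 a z *: M z + a z *: derive1 M z.
Proof.
move=> sa sM Oz; apply/matrixP => i j.
rewrite (derive1_mxE _ _ (smooth_scalemx sa sM) Oz) !mxE (derive1_mxE _ _ sM Oz).
rewrite -(derive1_mul sa (smooth_entry i j oO sM) Oz).
by congr (derive1 _ z); apply/funext => t; rewrite mxE.
Qed.

Lemma derive1_addmx p q (M N : K -> 'M[K]_(p, q)) z :
  smooth O M -> smooth O N -> O z ->
  derive1 (M \+ N) z = derive1 M z + derive1 N z.
Proof.
move=> sM sN Oz; apply/matrixP => i j.
rewrite (derive1_mxE _ _ (smoothD oO sM sN) Oz) mxE.
rewrite (derive1_mxE _ _ sM Oz) (derive1_mxE _ _ sN Oz).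
rewrite -(derive1_add (smooth_entry i j oO sM) (smooth_entry i j oO sN) Oz).
by congr (derive1 _ z); apply/funext => t; rewrite mxE.
Qed.

Lemma derive1_summx p q (r : seq nat) (M : nat -> K -> 'M[K]_(p, q)) z :
  (forall i, smooth O (M i)) -> O z ->
  derive1 (fun t => \sum_(i <- r) M i t) z = \sum_(i <- r) derive1 (M i) z.
Proof.
move=> sM Oz; elim: r => [|i r IH].
  rewrite big_nil -[RHS](derive1_cst (0 : 'M[K]_(p, q)) z).
  by apply: (derive1_ext oO Oz) => t _; rewrite big_nil.
rewrite big_cons -IH -derive1_addmx //; last exact: smooth_sum.
by apply: (derive1_ext oO Oz) => t _; rewrite big_cons.
Qed.

Lemma smooth_det p (M : K -> 'M[K]_p) : smooth O M -> smooth O (fun z => \det (M z)).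
Proof.
move=> sM; have sP (s : 'S_p) : smooth O (fun z => (-1) ^+ s * \prod_i M z i (s i)).
  by apply: smoothZ => //; apply: smooth_prod => // i; exact: smooth_entry.
exact: smooth_sum oO sP.
Qed.

(** By Cramer's rule. *)
Lemma smooth_invmx p (M : K -> 'M[K]_p) : smooth O M ->
  (forall z, O z -> M z \in unitmx) -> smooth O (fun z => invmx (M z)).
Proof.
move=> sM uM.
have sdet : smooth O (fun z => (\det (M z))^-1).
  apply: smoothV => // [z Oz|]; last exact: smooth_det.
  by have := uM z Oz; rewrite unitmxE unitfE.
have sadj : smooth O (fun z => \adj (M z)).
  apply/(smooth_mxP _ oO) => i j.
  have sc : smooth O (fun z => row' j (col' i (M z))).
    apply/(smooth_mxP _ oO) => k l.
    apply: (smooth_ext oO _ (smooth_entry (lift j k) (lift i l) oO sM)) => z _.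
    by rewrite !mxE.
  apply: (smooth_ext oO _ (smoothZ ((-1) ^+ (j + i)) oO (smooth_det sc))) => z _.
  by rewrite mxE.
apply: (smooth_ext oO _ (smooth_scalemx sdet sadj)) => z Oz.
by rewrite /invmx uM.
Qed.

Lemma smooth_comp1 (J : set K) (f g : K -> K) : (forall z, O z -> J (f z)) ->
  smooth O f -> smooth J g -> smooth O (g \o f).
Proof.
move=> OJ sf sg; pose l (_ : unit) : {linear K -> K} := idfun.
have cl i : continuous (l i) by move=> x; exact: cvg_id.
have basis (y : K) : y = \sum_i l i y *: (1 : K).
  by rewrite (big_pred1 tt) /= ?[_ *: 1]mulr1 //; case.
exact: smooth_comp_coord oO cl basis OJ sf sg.
Qed.

End MatrixProducts.

Section Expansion.
Variables (K : numFieldType) (m : nat) (D : set K) (oD : open D).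
Variables (f : K -> K) (T : K -> 'M[K]_m).
Hypotheses (pf : parameter D f) (sT : smooth D T).

Let a z := (derive1 f z)^-1.
Let sa : smooth D a := smooth_rate oD pf.

(** The matrix coefficient of the derivative of order [i] of [w] in the
    derivative of order [j] of [T w] with respect to [f]. *)
Fixpoint expansion j i : K -> 'M[K]_m :=
  match j with
  | 0 => if i == 0%N then T else cst 0
  | j'.+1 => fun z => a z *:
      (derive1 (expansion j' i) z + (if i is i'.+1 then expansion j' i' z else 0))
  end.

Lemma smooth_expansion j i : smooth D (expansion j i).
Proof.
elim: j i => [|j IH] i /=; first by case: eqP => // _; exact: smooth_cst.
apply: smooth_scalemx => //; case: i => [|i].
  apply: (smooth_ext oD _ (smooth_derive1 (IH 0%N))) => z _.
  by rewrite addr0.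
exact: smoothD oD (smooth_derive1 (IH i.+1)) (IH i).
Qed.

Lemma expansion_gt j i : (j < i)%N -> expansion j i = cst 0.
Proof.
elim: j i => [|j IH] [|i] //= ji; apply/funext => z.
rewrite (IH i.+1) ?(IH i) //; last exact: ltnW.
by rewrite derive1_cst addr0 scaler0.
Qed.

Lemma expansion_diag j z : expansion j j z = a z ^+ j *: T z.
Proof.
elim: j z => [|j IH] z /=; first by rewrite expr0 scale1r.
by rewrite expansion_gt // derive1_cst add0r IH scalerA exprS.
Qed.

(** Exactly one of the [j + 1] differentiations hits [T] or an earlier factor [a]
    instead of [w]. *)
Lemma expansion_subdiag j z : D z -> expansion j.+1 j z =
  (j.+1%:R * a z ^+ j.+1) *: derive1 T z +
  ('C(j.+1, 2)%:R * a z ^+ j * derive1 a z) *: T z.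
Proof.
elim: j z => [|j IH] z Dz.
  by rewrite /= addr0 bin_small // !mul0r scale0r addr0 mul1r expr1.
rewrite -[LHS]/(a z *: (derive1 (expansion j.+1 j.+1) z + expansion j.+1 j z)) IH //.
have -> : derive1 (expansion j.+1 j.+1) z =
    (j.+1%:R * a z ^+ j * derive1 a z) *: T z + a z ^+ j.+1 *: derive1 T z.
  rewrite -(derive1_exp j.+1 sa Dz) -(derive1_scalemx oD (smoothX j.+1 oD sa) sT Dz).
  by apply: (derive1_ext oD Dz) => t Dt; exact: expansion_diag.
have -> : 'C(j.+2, 2)%:R = 'C(j.+1, 2)%:R + j.+1%:R :> K by rewrite binS bin1 natrD.
have -> : j.+2%:R = 1 + j.+1%:R :> K by rewrite -[j.+2]add1n natrD.
rewrite scalerDr scalerDr scalerDr !scalerA; apply/matrixP => k l; rewrite !mxE.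
by rewrite !exprS; ring.
Qed.

Lemma dx_linear O (w : K -> 'cV[K]_m) j z : open O -> O `<=` D -> smooth O w -> O z ->
  dx f j (fun t => T t *m w t) z = \sum_(0 <= i < j.+1) expansion j i z *m derive1n i w z.
Proof.
move=> oO OD sw; elim: j z => [|j IH] z Oz; first by rewrite big_nat1.
have sd i : smooth O (derive1n i w).
  by elim: i => // i IHi; rewrite derive1nS; exact: smooth_derive1.
have se i : smooth O (expansion j i) by exact: smooth_subset (smooth_expansion j i).
rewrite -[LHS]/(a z *: derive1 (dx f j (fun t => T t *m w t)) z).
have -> : derive1 (dx f j (fun t => T t *m w t)) z =
    derive1 (fun t => \sum_(0 <= i < j.+1) expansion j i t *m derive1n i w t) z.
  by apply: (derive1_ext oO Oz) => t Ot; exact: IH.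
rewrite (derive1_summx oO _ _ Oz); last by move=> i; exact: smooth_mulmx.
have -> : \sum_(0 <= i < j.+1) derive1 (fun t => expansion j i t *m derive1n i w t) z =
    \sum_(0 <= i < j.+1) derive1 (expansion j i) z *m derive1n i w z +
    \sum_(0 <= i < j.+1) expansion j i z *m derive1n i.+1 w z.
  by rewrite -big_split /=; apply: eq_bigr => i _; rewrite (derive1_mulmx oO (se i) (sd i) Oz).
have E : \sum_(0 <= i < j.+1) expansion j.+1 i.+1 z *m derive1n i.+1 w z = a z *: (
    \sum_(0 <= i < j.+1) derive1 (expansion j i.+1) z *m derive1n i.+1 w z +
    \sum_(0 <= i < j.+1) expansion j i z *m derive1n i.+1 w z).
  rewrite -big_split scaler_sumr; apply: eq_bigr => i _.
  by rewrite /= -mulmxDl scalemxAl.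
rewrite [RHS]big_nat_recl // E /= addr0 -scalemxAl -scalerDr addrA.
congr (_ *: (_ + _)).
rewrite [LHS]big_nat_recl // [in RHS]big_nat_recr //= (expansion_gt (ltnSn j)) derive1_cst.
by rewrite mul0mx addr0.
Qed.

End Expansion.

(** * Linear transformations are equivalences *)
Section Sufficiency.
Variables (K : numFieldType) (m n : nat).
Local Notation V := 'cV[K]_m.
Variables (D : set K) (W : set V) (oD : open D).
Variables (phi : point_transformation K m) (f : K -> K) (T : K -> 'M[K]_m).
Hypotheses (pf : parameter D f) (sT : smooth D T).
Hypothesis uT : forall z, D z -> T z \in unitmx.
Hypothesis phiE : forall z w, D z -> W w -> phi (z, w) = (f z, T z *m w).
Local Notation A := (expansion f T).

Lemma dx_ext O (X X' : K -> K) (Y Y' : K -> V) j z : open O ->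
  (forall t, O t -> X t = X' t) -> (forall t, O t -> Y t = Y' t) -> O z ->
  dx X j Y z = dx X' j Y' z.
Proof.
move=> oO XX YY; elim: j z => [|j IH] z Oz /=; first exact: YY.
by rewrite (derive1_ext oO Oz XX) (derive1_ext oO Oz IH).
Qed.

Lemma expansion_diag_unit j z : D z -> A j j z \in unitmx.
Proof.
move=> Dz; rewrite expansion_diag unitmxZ ?uT // unitfE expf_neq0 // invr_eq0.
exact: pf.2.
Qed.

(** The coefficients obtained by substitution, divided by the leading one. *)
Definition transformed (B : coefficients K m) : coefficients K m := fun k z =>
  invmx (A n n z) *m
    (A n (n - k)%N z + \sum_(1 <= l < n.+1) B l (f z) *m A (n - l)%N (n - k)%N z).

Lemma smooth_transformed B (J : set K) k : open J -> (forall z, D z -> J (f z)) ->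
  general_family n J B -> smooth D (transformed B k).
Proof.
move=> oJ fJ gB; apply: (smooth_mulmx oD).
  by apply: (smooth_invmx oD) => [|z]; [exact: smooth_expansion|exact: expansion_diag_unit].
apply: (smoothD oD); first exact: smooth_expansion.
have sB l : smooth D (fun z => if (1 <= l <= n)%N then
    B l (f z) *m A (n - l)%N (n - k)%N z else 0).
  case: (boolP (1 <= l <= n)%N) => [ln|_]; last exact: smooth_cst.
  apply: (smooth_mulmx oD); last exact: smooth_expansion.
  apply/(smooth_mxP _ oD) => i j.
  apply: (smooth_comp1 oD (g := fun x => B l x i j) fJ); first by case: pf.
  by apply: smooth_entry => //; exact: gB.
apply: (smooth_ext oD _ (smooth_sum (index_iota 1 n.+1) oD sB)) => z _.
by apply: eq_big_nat => l; rewrite ltnS => ->.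
Qed.

(** Both equations are linear forms in the jet of [w], and they differ by the
    invertible factor [A n n]. *)
Lemma transforms_transformed B : transforms n D W phi B (transformed B).
Proof.
move=> O w oO OD sw wW X Y X'0 z Oz; have Dz := OD _ Oz.
have EX t : O t -> X t = f t by move=> Ot; rewrite /X phiE //; [exact: OD|exact: wW].
have EY t : O t -> Y t = T t *m w t.
  by move=> Ot; rewrite /Y phiE //; [exact: OD|exact: wW].
have dxE j : (j <= n)%N -> dx X j Y z = \sum_(0 <= i < n.+1) A j i z *m derive1n i w z.
  move=> jn; rewrite (dx_ext j oO EX EY Oz) (dx_linear oD pf sT j oO OD sw Oz).
  rewrite (big_cat_nat (n := j.+1) (p := n.+1)) //= [X in _ = _ + X]big_nat.
  rewrite [X in _ = _ + X]big1 ?addr0 // => i /andP[ji _].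
  by rewrite expansion_gt // mul0mx.
pose E i := A n i z + \sum_(1 <= l < n.+1) B l (f z) *m A (n - l)%N i z.
have lhsE : dx X n Y z + \sum_(1 <= k < n.+1) B k (X z) *m dx X (n - k) Y z =
    \sum_(0 <= i < n.+1) E i *m derive1n i w z.
  rewrite dxE // EX // [X in _ + X](_ : _ = \sum_(0 <= i < n.+1)
    (\sum_(1 <= l < n.+1) B l (f z) *m A (n - l)%N i z) *m derive1n i w z).
    by rewrite -big_split /=; apply: eq_bigr => i _; rewrite mulmxDl.
  under eq_bigr => k _ do rewrite dxE ?leq_subr // mulmx_sumr.
  rewrite exchange_big /=; apply: eq_bigr => i _; rewrite mulmx_suml.
  by apply: eq_bigr => k _; rewrite mulmxA.
have En : E n = A n n z.
  rewrite /E big_nat big1 ?addr0 // => l /andP[l1 ln].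
  by rewrite expansion_gt ?mulmx0 // ltn_subrL l1 (leq_trans l1).
have uA := expansion_diag_unit n Dz.
have rhsE : derive1n n w z + \sum_(1 <= k < n.+1) transformed B k z *m derive1n (n - k) w z =
    invmx (A n n z) *m (\sum_(0 <= i < n.+1) E i *m derive1n i w z).
  rewrite mulmx_sumr [RHS]big_nat_rev /= [RHS]big_ltn // add0n subn1 /= En mulmxA mulVmx //.
  rewrite mul1mx.
  congr (_ + _); apply: eq_big_nat => k _; rewrite subSS mulmxA.
  by [].
rewrite /jet_equation lhsE rhsE; split=> [->|E0]; first by rewrite mulmx0.
by rewrite -[LHS](mulKVmx uA) E0 mulmx0.
Qed.

(** The quotient of ['C(n, 2)] by [n] is [(n - 1) / 2], and the inverse of [f'] has
    derivative [- f'' / f' ^ 2]: this is where the exponent of the normal form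
    comes from. *)
Lemma expansion_subdiag_eq0 z : (1 < n)%N -> D z ->
  A n n.-1 z = 0 <->
  (2%:R * derive1 f z) *: derive1 T z = (n.-1%:R * derive1 (derive1 f) z) *: T z.
Proof.
move=> n1 Dz; have f0 : derive1 f z != 0 := pf.2 _ Dz.
have a' : derive1 (fun t => (derive1 f t)^-1) z =
    - derive1 (derive1 f) z / derive1 f z ^+ 2.
  exact: (derive1_inv (smooth_derive1 pf.1) Dz f0).
case: n n1 => // p p1; rewrite -[p.+1.-1]/p (expansion_subdiag oD pf sT p Dz) a'.
set f1 := derive1 f z in f0 *; set f2 := derive1 (derive1 f) z.
have C2 : 'C(p.+1, 2)%:R = p.+1%:R * p%:R / 2%:R :> K.
  have /(congr1 (fun k => k%:R : K)) := mul_bin_diag p.+1 1.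
  by rewrite bin1 !natrM => ->; rewrite mulrAC divff ?mul1r ?pnatr_eq0.
have -> : (p.+1%:R * f1^-1 ^+ p.+1) *: derive1 T z +
    ('C(p.+1, 2)%:R * f1^-1 ^+ p * (- f2 / f1 ^+ 2)) *: T z =
    (p.+1%:R / 2%:R * f1^-1 ^+ p.+2) *:
      ((2%:R * f1) *: derive1 T z - (p%:R * f2) *: T z).
  rewrite scalerBr !scalerA C2 -scaleNr; congr (_ *: _ + _ *: _).
    by rewrite !exprS; field; rewrite f0.
  by rewrite !exprS !exprVn; field; rewrite f0 ?expf_neq0.
split=> [/eqP|->]; last by rewrite subrr scaler0.
rewrite scaler_eq0 mulf_eq0 mulf_eq0 !pnatr_eq0 invr_eq0 pnatr_eq0 expf_eq0 invr_eq0.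
by rewrite (negbTE f0) /= subr_eq0 => /eqP.
Qed.

Lemma transformed_normal B (J : set K) : (1 < n)%N -> (forall z, D z -> J (f z)) ->
  (forall x, J x -> B 1%N x = 0) ->
  (forall z, D z -> (2%:R * derive1 f z) *: derive1 T z =
                    (n.-1%:R * derive1 (derive1 f) z) *: T z) ->
  forall z, D z -> transformed B 1%N z = 0.
Proof.
move=> n1 fJ B1 ode z Dz; rewrite /transformed subn1.
have -> : A n n.-1 z = 0 by apply/(expansion_subdiag_eq0 n1 Dz); exact: ode.
rewrite add0r big_nat big1 ?mulmx0 // => l /andP[l1 ln].
case: l l1 ln => // [[|l]] _ ln; first by rewrite B1 ?mul0mx //; exact: fJ.
rewrite expansion_gt ?mulmx0 //; rewrite ltnS in ln.
by rewrite -subn1 ltn_sub2l // (leq_trans _ ln).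
Qed.

End Sufficiency.

(** * Equivalences are linear transformations *)
Section Necessity.
Variables (K : numFieldType) (hK : constants_of_derivation K).
Variables (m n : nat) (n1 : (1 < n)%N) (m0 : (0 < m)%N).
Local Notation V := 'cV[K]_m.
Variables (D : set K) (W : set V) (hD : domain D) (hW : domain W).
Variables (phi : point_transformation K m).
Let U := D `*` W.
Hypothesis hphi : invertible_on U phi.
Variables (C0 C1 : coefficients K m).
Hypothesis tr0 : transforms n D W phi (scalar_system m n 0) C0.
Hypothesis tr1 : transforms n D W phi (scalar_system m n 1) C1.
Variables (w0 : V) (Ww0 : W w0).

Let oD : open D. Proof. by case: hD. Qed.
Let oW : open W. Proof. by case: hW. Qed.
Let sphi : smooth U phi. Proof. by case: hphi. Qed.

Definition base_map z : K := fx phi (z, w0).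
Definition fibre_map z : 'M[K]_m := ty_jacobian phi (z, w0).

Let cst_curve : curve_in U D (cst w0).
Proof. by split; [exact: smooth_cst|move=> z Dz; split]. Qed.

Lemma smooth_base_map : smooth D base_map.
Proof. exact: (smooth_curve_in oD (smooth_fx oD oW sphi) cst_curve). Qed.

Lemma smooth_fibre_map : smooth D fibre_map.
Proof.
apply/(smooth_mxP _ oD) => i j.
have sg := smooth_derive ((0, delta_mx j 0) : K * V) (smooth_ty oD oW sphi i).
by apply: (smooth_ext oD _ (smooth_curve_in oD sg cst_curve)) => z _; rewrite mxE.
Qed.

Lemma parameter_base_map : parameter D base_map.
Proof.
split=> [|z Dz]; first exact: smooth_base_map.
by rewrite (fx_derive1 hD hW hphi Dz Ww0) (fx_horizontal n1 hD hW hphi tr0 tr1).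
Qed.

Lemma fibre_map_unit z : D z -> fibre_map z \in unitmx.
Proof. by move=> Dz; apply: (ty_jacobian_unit n1 hD hW hphi tr0 tr1); split. Qed.

Lemma straightened z w : D z -> W w -> phi (z, w) = (base_map z, fibre_map z *m w).
Proof.
move=> Dz Ww; rewrite [LHS]surjective_pairing; congr pair.
  exact: (fx_const hK n1 hD hW hphi tr0 tr1 Dz Ww Ww0).
apply/colP => i; rewrite /fibre_map.
rewrite (ty_jacobian_const hK n1 m0 hD hW hphi tr0 tr1 Dz Ww0 Ww).
exact: (ty_linear hK n1 m0 hD hW hphi tr0 tr1).
Qed.

Local Notation A := (expansion base_map fibre_map).

(** When the transformed trivial equation has no term of order [n - 1], changing
    that derivative alone must not affect the expansion of order [n]. *)
Lemma expansion_subdiag_normal z : D z -> C0 1%N z = 0 -> A n n.-1 z = 0.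
Proof.
move=> Dz C01; have n0 : (0 < n)%N := ltnW n1.
have sol (u : nat -> V) : u 0%N = w0 ->
    \sum_(0 <= i < n.+1) A n i z *m complete_jet n C0 z u i = 0.
  move=> u0; have Wu : W (u 0%N) by rewrite u0.
  have X0 : 'D_(1, 0) (fx phi) (z, u 0%N) + 'D_(0, u 1%N) (fx phi) (z, u 0%N) != 0.
    rewrite (fx_vertical n1 hD hW hphi tr0 tr1) // addr0.
    exact: (fx_horizontal n1 hD hW hphi tr0 tr1).
  have [N Nz [oN ND [sw wU] [sX X'0]]] := solution_admissible n1 oD oW sphi Dz C0 Wu X0.
  set w := solution n z C0 u in sw wU sX X'0.
  have [_] := tr0 oN ND sw (fun t Nt => (wU t Nt).2) X'0 Nz.
  have wj j : (j <= n)%N -> derive1n j w z = complete_jet n C0 z u j.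
    exact: derive1n_jet_curve.
  set J := jet_equation n C0 _ _; have HJ : J.
    exact/(jet_equation_ext C0 z wj)/complete_jet_equation.
  move=> /(_ HJ) /(scalar_system_jet _ _ _ n0); rewrite scale0r addr0.
  rewrite (@dx_ext _ _ N _ base_map _ (fun t => fibre_map t *m w t) n z oN) //.
  - rewrite (dx_linear oD parameter_base_map smooth_fibre_map n oN ND sw Nz) => E.
    by rewrite -[RHS]E; apply: eq_big_nat => i /andP[_ iN]; rewrite wj.
  - by move=> t Nt; have [Dt Wt] := wU t Nt; rewrite straightened.
  - by move=> t Nt; have [Dt Wt] := wU t Nt; rewrite straightened.
have n1n : (n.-1 < n)%N by rewrite ltn_predL.
suff H (e : V) : A n n.-1 z *m e = 0.
  by apply/matrixP => i j; have /colP/(_ i) := H (delta_mx j 0); rewrite -colE !mxE.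
pose up := first_jet w0 (0 : V); pose ue j : V := if j == n.-1 then e else 0.
have ue0 : ue 0%N = 0 by rewrite /ue; case: n n1 => [|[]].
have E1 : \sum_(0 <= i < n.+1) A n i z *m complete_jet n C0 z (fun j => up j + ue j) i = 0.
  by apply: sol; rewrite ue0 addr0.
have E0 : \sum_(0 <= i < n.+1) A n i z *m complete_jet n C0 z up i = 0 by exact: sol.
have {E1} : \sum_(0 <= i < n.+1) A n i z *m complete_jet n C0 z ue i = 0.
  move: E1; under eq_bigr => i _ do rewrite complete_jetD mulmxDr.
  by rewrite big_split /= E0 add0r.
rewrite (bigD1_seq n.-1) ?iota_uniq ?mem_index_iota //=; last first.
  by rewrite ltnS leq_pred.
rewrite complete_jet_lt // {1}/ue eqxx big1_seq ?addr0 // => i /andP[ine _].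
rewrite /complete_jet; case: eqP => _; last by rewrite /ue (negbTE ine) mulmx0.
rewrite big_nat big1 ?oppr0 ?mulmx0 // => k /andP[k1 kn].
rewrite /ue; case: eqP => [nk|_]; last by rewrite mulmx0.
have -> : k = 1%N by move: nk k1 kn; lia.
by rewrite C01 mul0mx.
Qed.

End Necessity.

(** * Half powers of the first derivative *)
Section HalfPowers.
Variables (K : numFieldType) (D : set K) (f : K -> K) (p : nat).
Hypotheses (oD : open D) (pf : parameter D f).

Let sf' : smooth D (derive1 f). Proof. by apply: smooth_derive1; case: pf. Qed.
Let f'0 z : D z -> derive1 f z != 0. Proof. by case: pf => _; exact. Qed.

Lemma half_power_neq0 g z : half_power D (derive1 f) p g -> D z -> g z != 0.
Proof.
move=> [_ [c c0 gE]] Dz; have := mulf_neq0 c0 (expf_neq0 p (f'0 Dz)).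
by rewrite -gE // expf_eq0.
Qed.

(** Differentiate [g ^ 2 = c * f' ^ p]. *)
Lemma half_power_ode g z : half_power D (derive1 f) p g -> D z ->
  2%:R * derive1 f z * derive1 g z = p%:R * derive1 (derive1 f) z * g z.
Proof.
move=> hg Dz; have g0 := half_power_neq0 hg Dz; have [sg [c _ gE]] := hg.
have E : derive1 (fun t => g t ^+ 2) z = derive1 (fun t => c * derive1 f t ^+ p) z.
  exact: (derive1_ext oD Dz).
rewrite (derive1_scale c (smoothX p oD sf') Dz) in E.
rewrite (derive1_exp 2 sg Dz) (derive1_exp p sf' Dz) /= expr1 in E.
apply: (mulfI g0); transitivity (derive1 f z * (2%:R * g z * derive1 g z)); first by ring.
rewrite E [RHS]mulrC -[RHS]mulrA -expr2 gE //.
by case: {E gE hg} p => [|q]; rewrite ?mul0r ?mulr0 //= exprS; ring.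
Qed.

Hypotheses (hK : constants_of_derivation K) (hD : domain D).

(** Both factors vary like the power [p / 2] of [f'], hence their product varies
    like [f' ^ p]. *)
Lemma ode_product_const u v z t :
  smooth D u -> smooth D v ->
  (forall z, D z -> 2%:R * derive1 f z * derive1 u z = p%:R * derive1 (derive1 f) z * u z) ->
  (forall z, D z -> 2%:R * derive1 f z * derive1 v z = p%:R * derive1 (derive1 f) z * v z) ->
  D z -> D t ->
  u z * v z * (derive1 f z)^-1 ^+ p = u t * v t * (derive1 f t)^-1 ^+ p.
Proof.
move=> su sv ou ov; pose a s := (derive1 f s)^-1.
have sa : smooth D a by exact: smooth_rate.
have sh := smoothM oD (smoothM oD su sv) (smoothX p oD sa).
apply: (derive1_eq0_connected hK hD sh) => s Ds.
rewrite (derive1_mul (smoothM oD su sv) (smoothX p oD sa) Ds) (derive1_mul su sv Ds).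
rewrite (derive1_exp p sa Ds) (derive1_inv sf' Ds (f'0 Ds)) /a /=.
have x0 := f'0 Ds; move: (ou s Ds) (ov s Ds) x0.
move: (derive1 u s) (derive1 v s) (derive1 (derive1 f) s) (derive1 f s) (u s) (v s).
move=> u' v' x' x u1 v1 Eu Ev x0.
have x2 : 2%:R * x != 0 by rewrite mulf_neq0 ?pnatr_eq0.
have -> : u' = p%:R * x' * u1 / (2%:R * x) by rewrite -Eu mulrAC divff ?mul1r.
have -> : v' = p%:R * x' * v1 / (2%:R * x) by rewrite -Ev mulrAC divff ?mul1r.
case: p => [|q]; first by rewrite !(mulr0n, mul0r, mulr0, addr0).
by rewrite /= exprS !exprVn; field; rewrite x0 expf_neq0.
Qed.

(** Any nonzero entry of [T] at one point can serve as [g]: its square is a nonzero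
    constant times [f' ^ p], hence it vanishes nowhere, and its products with the
    other entries show them to be proportional to it. *)
Lemma ode_half_power m (T : K -> 'M[K]_m) : (0 < m)%N -> smooth D T ->
  (forall z, D z -> T z \in unitmx) ->
  (forall z, D z -> (2%:R * derive1 f z) *: derive1 T z =
                    (p%:R * derive1 (derive1 f) z) *: T z) ->
  exists (g : K -> K) (C : 'M[K]_m),
    [/\ half_power D (derive1 f) p g, C \in unitmx &
        forall z, D z -> T z = g z *: C].
Proof.
move=> m0 sT uT ode; have [_ _ [z0 Dz0]] := hD.
have sTe i j : smooth D (fun z => T z i j) by exact: smooth_entry.
have odee i j z : D z -> 2%:R * derive1 f z * derive1 (fun t => T t i j) z =
    p%:R * derive1 (derive1 f) z * T z i j.
  by move=> Dz; have /matrixP/(_ i j) := ode z Dz; rewrite !mxE (derive1_mxE _ _ sT Dz).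
have [[i j] T0] : exists ij, T z0 ij.1 ij.2 != 0.
  apply: contrapT => nT; have T00 : T z0 = 0.
    apply/matrixP => i j; rewrite mxE; apply/eqP; apply: contraT => Tij.
    by case: nT; exists (i, j).
  have := uT _ Dz0; rewrite T00 unitmxE unitfE.
  by case: m m0 {T sT uT ode sTe odee nT T00} => // m' _; rewrite det0 eqxx.
pose g z := T z i j; pose a z := (derive1 f z)^-1.
have a0 z : D z -> a z != 0 by move=> Dz; rewrite invr_eq0 f'0.
have cst_ k l z : D z -> T z k l * g z * a z ^+ p = T z0 k l * g z0 * a z0 ^+ p.
  by move=> Dz; apply: (ode_product_const (sTe k l) (sTe i j)) => //; exact: odee.
pose c := g z0 * g z0 * a z0 ^+ p.
have c0 : c != 0 by rewrite !mulf_neq0 // expf_neq0 // a0.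
have gE z : D z -> g z ^+ 2 = c * derive1 f z ^+ p.
  move=> Dz; rewrite /c -(cst_ i j z Dz) -/(g z) expr2 /a exprVn mulfVK //.
  by rewrite expf_neq0 // f'0.
have g0 z : D z -> g z != 0.
  move=> Dz; have := mulf_neq0 c0 (expf_neq0 p (f'0 Dz)).
  by rewrite -gE // expf_eq0.
pose C := \matrix_(k, l) (T z0 k l * g z0 * a z0 ^+ p / c).
have TE z : D z -> T z = g z *: C.
  move=> Dz; apply/matrixP => k l; rewrite !mxE -(cst_ k l z Dz).
  have -> : c = g z * g z * a z ^+ p by rewrite /c -(cst_ i j z Dz).
  by have ap := expf_neq0 p (a0 z Dz); have gz := g0 z Dz; field; rewrite gz ap.
exists g, C; split=> //; first by split; [exact: sTe|exists c].
by have := uT _ Dz0; rewrite TE // unitmxZ // unitfE g0.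
Qed.

End HalfPowers.

(** * The equivalence groups *)
Theorem theorem1 (K : numFieldType) (hK : constants_of_derivation K)
    (m n : nat) (hm : (1 <= m)%N) (hn : (2 <= n)%N)
    (D : set K) (W : set 'cV[K]_m) (hD : domain D) (hW : domain W)
    (phi : point_transformation K m) :
  (equivalence_transformation n (@general_family K m n) D W phi <->
     invertible_on (D `*` W) phi /\
     exists (f : K -> K) (T : K -> 'M[K]_m),
       [/\ smooth D f, smooth D T,
           forall z, D z -> derive1 f z != 0 /\ T z \in unitmx &
           forall z w, D z -> W w -> phi (z, w) = (f z, T z *m w)]) /\
  (equivalence_transformation n (@normal_family K m n) D W phi <->
     invertible_on (D `*` W) phi /\
     exists (f g : K -> K) (C : 'M[K]_m),
       [/\ smooth D f, forall z, D z -> derive1 f z != 0,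
           half_power D (derive1 f) n.-1 g, C \in unitmx &
           forall z w, D z -> W w -> phi (z, w) = (f z, g z *: (C *m w))]).
Proof.
have [oD _ _] := hD; have [oW _ [w0 Ww0]] := hW.
pose J : set K := fst @` (phi @` (D `*` W)).
have J_open : invertible_on (D `*` W) phi -> open J.
  by move=> [_ ophi _]; exact: fst_open.
have fJ (f : K -> K) (T : K -> 'M[K]_m) :
    (forall z w, D z -> W w -> phi (z, w) = (f z, T z *m w)) ->
    forall z, D z -> J (f z).
  move=> phiE z Dz; exists (phi (z, w0)); last by rewrite phiE.
  by exists (z, w0).
split; split.
- move=> [hphi eqv]; split=> //.
  have [C0 _ tr0] := eqv _ (scalar_system_normal m J 0 hn).1.
  have [C1 _ tr1] := eqv _ (scalar_system_normal m J 1 hn).1.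
  have [sf f'0] := parameter_base_map hn hD hW hphi tr0 tr1 Ww0.
  exists (base_map phi w0), (fibre_map phi w0); split=> //.
  + exact: (smooth_fibre_map hD hW hphi Ww0).
  + by move=> z Dz; split; [exact: f'0|exact: (fibre_map_unit hn hD hW hphi tr0 tr1)].
  + by move=> z w Dz Ww; exact: (straightened hK hn hm hD hW hphi tr0 tr1).
- move=> [hphi [f [T [sf sT fT0 phiE]]]]; split=> // B gB.
  have pf : parameter D f by split=> // z /fT0[].
  have uT z : D z -> T z \in unitmx by move=> /fT0[].
  exists (transformed n f T B); last exact: transforms_transformed.
  by move=> k _; exact: (smooth_transformed oD pf sT uT k (J_open hphi) (fJ _ _ phiE) gB).
- move=> [hphi eqv]; split=> //.
  have [C0 [_ C01] tr0] := eqv _ (scalar_system_normal m J 0 hn).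
  have [C1 _ tr1] := eqv _ (scalar_system_normal m J 1 hn).
  have pf := parameter_base_map hn hD hW hphi tr0 tr1 Ww0.
  have sT := smooth_fibre_map hD hW hphi Ww0.
  have uT z : D z -> fibre_map phi w0 z \in unitmx.
    by move=> Dz; exact: (fibre_map_unit hn hD hW hphi tr0 tr1).
  have ode z (Dz : D z) := (expansion_subdiag_eq0 oD pf sT hn Dz).1
    (expansion_subdiag_normal hK hn hm hD hW hphi tr0 tr1 Ww0 Dz (C01 z Dz)).
  have [g [C [hg uC TE]]] := ode_half_power oD pf hK hD hm sT uT ode.
  exists (base_map phi w0), g, C; split=> //; [by case: pf|by case: pf|].
  move=> z w Dz Ww; rewrite (straightened hK hn hm hD hW hphi tr0 tr1 Ww0 Dz Ww).
  by rewrite TE // scalemxAl.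
- move=> [hphi [f [g [C [sf f'0 hg uC phiE]]]]]; split=> // B [gB B1].
  have pf : parameter D f by [].
  have [sg _] := hg.
  pose T z := g z *: C.
  have sT : smooth D T by apply: smooth_scalemx => //; exact: smooth_cst.
  have uT z : D z -> T z \in unitmx.
    by move=> Dz; rewrite unitmxZ // unitfE (half_power_neq0 pf hg).
  have phiE' z w : D z -> W w -> phi (z, w) = (f z, T z *m w).
    by move=> Dz Ww; rewrite phiE // scalemxAl.
  have ode z : D z -> (2%:R * derive1 f z) *: derive1 T z =
      (n.-1%:R * derive1 (derive1 f) z) *: T z.
    move=> Dz; rewrite (derive1_scalemx oD sg (smooth_cst D C) Dz) derive1_cst.
    by rewrite scaler0 addr0 !scalerA (half_power_ode oD pf hg Dz).
  exists (transformed n f T B); last exact: transforms_transformed.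
  split; first by move=> k _; exact: (smooth_transformed oD pf sT uT k
    (J_open hphi) (fJ _ _ phiE') gB).
  by move=> z Dz; exact: (transformed_normal oD pf sT hn (fJ _ _ phiE') B1 ode).
Qed.
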